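(* The following hold: $$\operatorname{add}(\mathcal I_\square)=\omega_1,\qquad \operatorname{cof}(\mathcal I_\square)=\mathfrak c,$$ $$\mathfrak p\le\operatorname{cov}(\mathcal I_\square)\le\operatorname{add}(\mathcal M),\qquad \operatorname{cof}(\mathcal M)\le\operatorname{non}(\mathcal I_\square)\le\mathfrak c,$$ $$\operatorname{dens}(X,\tau_\square)=\pi\mathrm w(X,\tau_\square)=\operatorname{dens}(\mathbb P_\square)=\mathfrak d.$$
   Context: Let $X=(\omega^2)^\omega$. $\mathbb P_\square$ is the set of nonempty trees $T\subseteq(\omega^2)^{<\omega}$, closed under initial segments, with a stem (the longest node common to all branches, below which the tree has one path) such that for every $t\in T$ with $t\supseteq\operatorname{stem}(T)$ the successor set $\{a:t^\frown a\in T\}$ contains a final quadrant $E_N=[N,\infty)^2$ for some $N<\omega$; the order is inclusion. The bodies $[T]=\{x\in X:\forall n\ x\restriction n\in T\}$, $T\in\mathbb P_\square$, form a base of a topology $\tau_\square$ on $X$. Put $$\mathcal N_\square=\{A\subseteq X:\forall T\in\mathbb P_\square\ \exists S\le T\ ([S]\cap A=\varnothing)\}$$ (the nowhere dense sets of $\tau_\square$), and let $\mathcal I_\square$ be the $\sigma$-ideal generated by $\mathcal N_\square$ (the meager ideal of $\tau_\square$). $\mathcal M$ is the usual meager ideal on $2^\omega$. For a proper ideal $I$ on a set $Z$: $\operatorname{add}(I)$ is the least size of a subfamily of $I$ with union outside $I$; $\operatorname{cov}(I)$ the least size of a subfamily of $I$ covering $Z$; $\operatorname{non}(I)$ the least size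 of a subset of $Z$ not in $I$; $\operatorname{cof}(I)$ the least size of a cofinal subfamily of $(I,\subseteq)$. $\mathfrak d$ is the dominating number, $\mathfrak c=2^{\aleph_0}$, and $\mathfrak p$ is the pseudointersection number: the least size of a family of infinite subsets of $\omega$ all of whose finite intersections are infinite, with no infinite set almost contained in every member. For a topological space, $\operatorname{dens}$ is the least size of a dense set and $\pi\mathrm w$ is the least size of a family of nonempty open sets such that every nonempty open set contains a member. For a partial order $P$, $\operatorname{dens}(P)$ is the least size of a dense subset of $P$. *)

(* Defs.v *)
From HB Require Import structures.
From mathcomp Require Import all_boot.
From mathcomp Require Import boolp classical_sets functions cardinality topology.
From mathcomp Require Import cantor.

Set Implicit Arguments.
Unset Strict Implicit.
Unset Printing Implicit Defensive.

Local Open Scope classical_set_scope.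
Local Open Scope card_scope.

(* A cardinal is rendered as the class of all sets having that size.
   In [=c] and [<=c] below, the existential witnesses make the existence of
   both cardinals (e.g. that a least size is attained) part of the claim. *)
Definition cardinal := forall U : Type, set U -> Prop.

Definition card_same (k l : cardinal) :=
  exists (U : Type) (K : set U), k U K /\ l U K.

Definition card_leq (k l : cardinal) :=
  exists (U : Type) (K : set U) (V : Type) (L : set V),
    [/\ k U K, l V L & K #<= L].

Notation "k =c l" := (card_same k l) (at level 70, no associativity).
Notation "k <=c l" := (card_leq k l) (at level 70, no associativity).

Definition least_size (T : Type) (F : set (set T)) : cardinal := fun U K =>
  (exists2 A, F A & A #= K) /\ (forall A, F A -> K #<= A).

Definition omega1 : cardinal := fun U K =>
  ~ countable K /\
  forall (V : Type) (B : set V), ~ countable B -> K #<= B.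

Definition continuum : cardinal := fun U K => K #= [set: nat -> bool].

Section ideal_invariants.
Variables (Z : Type) (I : set (set Z)).

Definition add_ideal : cardinal :=
  least_size [set F : set (set Z) | F `<=` I /\ ~ I (\bigcup_(A in F) A)].

Definition cov_ideal : cardinal :=
  least_size [set F : set (set Z) | F `<=` I /\ \bigcup_(A in F) A = setT].

Definition non_ideal : cardinal := least_size [set A : set Z | ~ I A].

Definition cof_ideal : cardinal :=
  least_size [set F : set (set Z) |
    F `<=` I /\ forall A, I A -> exists2 B, F B & A `<=` B].

Definition sigma_ideal :=
  [/\ I set0,
      (forall A B : set Z, A `<=` B -> I B -> I A) &
      (forall F : nat -> set Z, (forall n, I (F n)) -> I (\bigcup_n F n))].
End ideal_invariants.

Section topological_invariants.
Variable T : topologicalType.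

Definition dens : cardinal := least_size [set D : set T | dense D].

Definition piweight : cardinal :=
  least_size [set B : set (set T) |
    (forall U, B U -> open U /\ U !=set0) /\
    (forall O : set T, open O -> O !=set0 -> exists2 U, B U & U `<=` O)].

Definition nowhere_dense (A : set T) := interior (closure A) = set0.

Definition meager : set (set T) :=
  [set A | exists2 F : nat -> set T,
     (forall n, nowhere_dense (F n)) & A = \bigcup_n F n].
End topological_invariants.

Definition poset_dens (T : Type) (P : set T) (le : T -> T -> Prop) : cardinal :=
  least_size [set D : set T |
    D `<=` P /\ forall p, P p -> exists2 d, D d & le d p].

Definition dominating (D : set (nat -> nat)) :=
  forall f : nat -> nat, exists2 g, D g &
    exists N, forall n, N <= n -> f n <= g n.

Definition dominating_number : cardinal := least_size dominating.

Definition almost_subset (A B : set nat) := finite_set (A `\` B).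

Definition pseudointersection_number : cardinal :=
  least_size [set F : set (set nat) |
    [/\ (forall A, F A -> infinite_set A),
        (forall G : set (set nat), finite_set G -> G `<=` F ->
           infinite_set (\bigcap_(A in G) A)) &
        ~ exists2 B : set nat, infinite_set B &
            forall A, F A -> almost_subset B A]].

Section square_forcing.
Local Notation node := (seq (nat * nat)).

Definition comparable_nodes (s t : node) := prefix s t \/ prefix t s.

(* [s] lies on every branch of [T], and [T] has a single path up to [s]. *)
Definition trunk_node (T : set node) (s : node) :=
  T s /\ forall t, T t -> comparable_nodes s t.

Definition is_stem (T : set node) (s : node) :=
  trunk_node T s /\ forall s', trunk_node T s' -> size s' <= size s.

Definition quadrant (N : nat) : set (nat * nat) :=
  [set a | N <= a.1 /\ N <= a.2].

Definition successors (T : set node) (t : node) : set (nat * nat) :=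
  [set a | T (rcons t a)].

Definition P_square : set (set node) :=
  [set T | [/\ T !=set0,
     (forall s t, prefix s t -> T t -> T s) &
     exists2 s, is_stem T s &
       forall t, T t -> prefix s t ->
         exists N, quadrant N `<=` successors T t]].

End square_forcing.

(* A fresh name, so that the topology below is attached to it and not to the
   function space itself. *)
Definition Xsq : Type := nat -> nat * nat.

HB.instance Definition _ := Pointed.on Xsq.

Definition body (T : set (seq (nat * nat))) : set Xsq :=
  [set x | forall n, T (mkseq x n)].

Section square_topology.
Local Notation node := (seq (nat * nat)).

Lemma trunk_node_maximal (T : set node) s N :
  trunk_node T s -> quadrant N `<=` successors T s -> is_stem T s.
Proof.
move=> [Ts cs] qN; split=> // s' [Ts' cs']; rewrite leqNgt; apply/negP => lt.
have pre a : T (rcons s a) -> nth (0, 0) s' (size s) = a.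
  move=> /cs' [] /prefixP[u].
    move=> e; have : size (rcons s a) = size (s' ++ u) by rewrite e.
    rewrite size_rcons size_cat => sz.
    have u0 : u = [::] by apply/nilP; rewrite /nilp; move: lt sz;
      case: (size u) => // k; rewrite addnS => lt [] sz;
      move: lt; rewrite sz ltnNge leq_addr.
    by move: e; rewrite u0 cats0 => <-; rewrite nth_rcons ltnn eqxx.
  by move=> ->; rewrite nth_cat size_rcons ltnSn nth_rcons ltnn eqxx.
have := pre _ (qN (N, N) (conj (leqnn N) (leqnn N))).
have := pre _ (qN (N.+1, N) (conj (leqnSn N) (leqnn N))).
by move=> -> [] /eqP; rewrite -[X in _ == X]addn0 -addn1 eqn_add2l.
Qed.

Lemma prefix_mkseq (x : Xsq) m n : m <= n -> prefix (mkseq x m) (mkseq x n).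
Proof.
move=> mn; apply/prefixP; exists (map x (iota m (n - m))).
by rewrite /mkseq -map_cat -iotaD subnKC.
Qed.

Lemma stem_body (T : set node) s x :
  is_stem T s -> body T x -> s = mkseq x (size s).
Proof.
move=> [[_ cs] _] /(_ (size s)) /cs [] /prefixP[u e].
  have /eqP : size (mkseq x (size s)) = size (s ++ u) by rewrite e.
  rewrite size_mkseq size_cat -{1}[size s]addn0 eqn_add2l eq_sym => /nilP u0.
  by rewrite e u0 cats0.
have /eqP : size s = size (mkseq x (size s) ++ u) by rewrite -e.
rewrite size_cat size_mkseq -{1}[size s]addn0 eqn_add2l eq_sym => /nilP u0.
by rewrite {1}e u0 cats0.
Qed.

Lemma P_square_setT : P_square setT.
Proof.
split; [by exists [::]| by [] |exists [::]].
  apply: (@trunk_node_maximal _ _ 0) => //.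
  by split=> // t _; left; apply: prefix0s.
by move=> t _ _; exists 0.
Qed.

Lemma P_square_setI (S T : set node) (x : Xsq) :
  P_square S -> P_square T -> body S x -> body T x -> P_square (S `&` T).
Proof.
move=> [_ dS [s sS qS]] [_ dT [t sT qT]] xS xT.
have es := stem_body sS xS; have et := stem_body sT xT.
set r := mkseq x (maxn (size s) (size t)).
have sr : prefix s r by rewrite es; apply: prefix_mkseq; rewrite leq_maxl.
have tr : prefix t r by rewrite et; apply: prefix_mkseq; rewrite leq_maxr.
have q u : (S `&` T) u -> prefix r u ->
    exists N, quadrant N `<=` successors (S `&` T) u.
  move=> [Su Tu] ru.
  have [M qM] := qS u Su (prefix_trans sr ru).
  have [N qN] := qT u Tu (prefix_trans tr ru).
  exists (maxn M N) => a /= []; rewrite !geq_max.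
  by move=> /andP[M1 N1] /andP[M2 N2]; split; [apply: qM|apply: qN].
have STr : (S `&` T) r by split; [apply: xS|apply: xT].
split; first by exists r.
  by move=> u v uv [Sv Tv]; split; [apply: dS Sv|apply: dT Tv].
exists r => //; have [N qN] := q r STr (prefix_refl r).
apply: trunk_node_maximal qN; split=> // u [Su Tu].
have : r = s \/ r = t.
  by rewrite /r; case: (leqP (size s) (size t)) => _;
    [right; rewrite [RHS]et|left; rewrite [RHS]es].
by case=> ->; [apply: sS.1.2|apply: sT.1.2].
Qed.

Lemma body_cover : \bigcup_(T in P_square) body T = setT.
Proof.
by rewrite -subTset => x _; exists setT => //; exact: P_square_setT.
Qed.

Lemma body_join (S T : set node) (x : Xsq) :
  P_square S -> P_square T -> body S x -> body T x ->
  exists R, [/\ P_square R, body R x & body R `<=` body S `&` body T].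
Proof.
move=> PS PT xS xT; exists (S `&` T); split.
- exact: P_square_setI PS PT xS xT.
- by move=> n; split; [apply: xS|apply: xT].
- by move=> y yST; split=> n; case: (yST n).
Qed.

(* The topology whose open sets are the unions of bodies. *)
HB.instance Definition _ :=
  @isBaseTopological.Build Xsq (set node) P_square body body_cover body_join.

Definition N_square : set (set Xsq) :=
  [set A | forall T, P_square T ->
     exists S, [/\ P_square S, S `<=` T & body S `&` A = set0]].

Definition I_square : set (set Xsq) := smallest (@sigma_ideal Xsq) N_square.

End square_topology.

(* Main.v *)
(* Write [cyl s f] for the body of the tree with stem [s] in which every
   further step [a] after a node [t] lies in the quadrant [f t]. These sets form
   a pi-base, so all densities reduce to dominating functions on the countable
   set of nodes.

   For a nowhere dense [C], a rank argument gives below every node countably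
   many positive sets such that a branch following them escapes [C]. An almost
   disjoint family [A_g], [g] a real, almost contains each positive set for at
   most one [g], so a set of the ideal contains [{x | x avoids A_g}] for only
   countably many [g]; this yields [add = omega1] and [cof = c].

   A generic point codes both a Cohen real and a dominating real, and one of
   each (from two points) gives a meager set containing a prescribed meager set.
   With [k * k = k] for infinite [k], this compares [cov] with [add M] and [non]
   with [cof M]. For [p <= cov], a dominating function [f] reduces
   genericity to meeting few dense open subsets of the countable tree of
   [f]-admissible nodes. *)
Require Import Defs.
From mathcomp Require Import all_boot.
From mathcomp Require Import mathcomp_extra boolp classical_sets functions cardinality topology.
From mathcomp Require Import cantor.

Set Implicit Arguments.
Unset Strict Implicit.
Unset Printing Implicit Defensive.

Local Open Scope classical_set_scope.
Local Open Scope card_scope.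

Local Notation node := (seq (nat * nat)).
Local Notation at0 := (nth (0, 0)).

(** * Cardinal arithmetic *)

Lemma card_le_inj T U (A : set T) (B : set U) (f : T -> U) :
  (forall x, A x -> B (f x)) ->
  (forall x y, A x -> A y -> f x = f y -> x = y) -> A #<= B.
Proof.
move=> fAB fI; have [] : $|{injfun A >-> B}|.
  apply/injfunPex; exists f => [x /fAB //|x y].
  by rewrite !inE => Ax Ay; apply: fI.
by move=> g; apply: inj_card_le g.
Qed.

Lemma card_le_fun T U (A : set T) (B : set U) : A #<= B -> B !=set0 ->
  exists2 f : T -> U, forall x, B (f x) &
    forall x y, A x -> A y -> f x = f y -> x = y.
Proof.
move=> /card_leP/injfunPex[f _ fI] [b Bb].
pose g x := if pselect (A x) is left Ax then val (f (SigSub (mem_set Ax))) else b.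
exists g => [x|x y Ax Ay]; rewrite /g.
  by case: pselect => // Ax; apply: set_mem; apply: valP.
case: pselect => // Ax'; case: pselect => // Ay' /val_inj e.
by have /(congr1 val) := fI _ _ (mem_set Logic.I) (mem_set Logic.I) e.
Qed.

Lemma card_le_nonempty T U (A : set T) (B : set U) :
  A #<= B -> A !=set0 -> B !=set0.
Proof.
move=> AB [a Aa]; apply/set0P/eqP => B0; move: AB; rewrite B0 card_le0 => /eqP A0.
by move: Aa; rewrite A0.
Qed.

Lemma card_le_surj_fun T U (A : set T) (B : set U) : A #<= B -> A !=set0 ->
  exists2 f : U -> T, forall y, A (f y) &
    forall x, A x -> exists2 y, B y & f y = x.
Proof.
move=> AB [a Aa].
have [b Bb] : B !=set0 by apply: (card_le_nonempty AB); exists a.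
have [f fB fI] := card_le_fun AB (ex_intro _ b Bb).
have /choice[g gP] y : exists x, A x /\ ((exists2 z, A z & f z = y) -> f x = y).
  by case: (pselect (exists2 z, A z & f z = y)) => [[z Az <-]|n]; [exists z|exists a].
exists g => [y|x Ax]; first by case: (gP y).
exists (f x) => //; have [Agx e] := gP (f x).
by apply: fI => //; apply: e; exists x.
Qed.

(* A maximal set of selectors that differ pairwise at every member of [F]
   exhausts some member [A], and then injects [A] into all the others. *)
Lemma least_card T (F : set (set T)) : F !=set0 ->
  exists2 A, F A & forall B, F B -> A #<= B.
Proof.
move=> [A0 FA0]; case: (eqVneq A0 set0) => [A00|/set0P[x0 _]].
  by exists A0 => // B _; rewrite A00; apply: card_ge0.
pose P := [set R : set (set T -> T) |
  (forall r A, R r -> F A -> A (r A)) /\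
  (forall r r' A, R r -> R r' -> F A -> r A = r' A -> r = r')].
have [|R [[Rin RI] Rmax]] := @Zorn_bigcup _ P.
  move=> G GP tG; split=> [r A [X GX Xr] FA|r r' A [X GX Xr] [Y GY Yr'] FA].
    by case: (GP X GX) => /(_ r A Xr FA).
  case: (tG X Y GX GY) => XY e.
    by case: (GP Y GY) => _ /(_ r r' A (XY _ Xr) Yr' FA e).
  by case: (GP X GX) => _ /(_ r r' A Xr (XY _ Yr') FA e).
have [A FA AR] : exists2 A, F A & forall a, A a -> exists2 r, R r & r A = a.
  apply: contrapT => no.
  have /choice[r rP] A : exists a, F A -> A a /\ forall r, R r -> r A <> a.
    apply: contrapT => h.
    have FA : F A by apply: contrapT => nF; apply: h; exists x0.
    apply: no; exists A => // a Aa; apply: contrapT => na.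
    by apply: h; exists a => _; split=> // r Rr e; apply: na; exists r.
  have nRr : ~ R r by move=> Rr; have [_ /(_ r Rr)] := rP A0 FA0.
  apply: (Rmax (r |` R)).
    split=> [|RR]; first by move=> q Rq; right.
    by apply: nRr; apply: (RR r); left.
  split=> [q A [->|Rq] FA|q q' A [->|Rq] [->|Rq'] FA e] //.
  - by case: (rP A FA).
  - exact: (Rin q A).
  - by case: (rP A FA) => _ /(_ _ Rq'); rewrite e.
  - by case: (rP A FA) => _ /(_ _ Rq); rewrite e.
  - exact: (RI q q' A).
exists A => // B FB.
have /choice[q qP] a : exists r, A a -> R r /\ r A = a.
  by have [/AR[r]|] := pselect (A a); [exists r|exists (fun _ => x0)].
apply: (@card_le_inj _ _ _ _ (fun a => q a B)) => [a /qP[Rq _]|a b].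
  exact: (Rin (q a) B).
by move=> /qP[Ra ea] /qP[Rb eb] /(RI _ _ _ Ra Rb FB) e; rewrite -ea e.
Qed.

(** Tagged copies inside the sum type put both sets into one family, where [least_card] picks the
    smaller. *)
Lemma card_le_total T U (A : set T) (B : set U) : A #<= B \/ B #<= A.
Proof.
pose A' : set (T + U) := inl @` A; pose B' : set (T + U) := inr @` B.
have eA : A' #= A by apply: inj_card_eq => x y _ _ [].
have eB : B' #= B by apply: inj_card_eq => x y _ _ [].
have [|X [->|->] XP] := @least_card _ [set A'; B']; first by exists A'; left.
  by left; rewrite -(card_le_eql eA) -(card_le_eqr eB); apply: XP; right.
by right; rewrite -(card_le_eqr eA) -(card_le_eql eB); apply: XP; left.
Qed.

Section infinite_square.
Variables (T : Type) (A : set T).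

(** Partial pairing functions are kept as graphs, so that a chain has its union as a bound. The
    conditions of [square_inj] make [G] the graph of an injection from the square of [field G] into
    [field G]. *)
Let field (G : set (T * T * T)) := [set a | exists c, G (a, a, c)].

Let square_inj (G : set (T * T * T)) :=
  [/\ forall a b c, G (a, b, c) ->
        [/\ A a, A b, field G a, field G b & field G c],
      forall a b, field G a -> field G b -> exists c, G (a, b, c),
      forall a b c c', G (a, b, c) -> G (a, b, c') -> c = c' &
      forall a b a' b' c, G (a, b, c) -> G (a', b', c) -> a = a' /\ b = b'].

Let square_inj_bigcup (F : set (set (T * T * T))) :
  F `<=` square_inj -> total_on F subset -> square_inj (\bigcup_(G in F) G).
Proof.
move=> FQ tF.
have tF2 G H : F G -> F H -> exists2 K, F K & G `<=` K /\ H `<=` K.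
  by move=> FG FH; case: (tF G H FG FH) => GH; [exists H => //; split|exists G => //; split].
have sub G a : F G -> field G a -> field (\bigcup_(G in F) G) a.
  by move=> FG [c Gc]; exists c; exists G.
split=> [a b c [G FG Gabc]|a b [c [G FG Gc]] [d [H FH Hd]]
    |a b c c' [G FG Gc] [H FH Hc]|a b a' b' c [G FG Gc] [H FH Hc]].
- have [/(_ _ _ _ Gabc)[Aa Ab fa fb fc] _ _ _] := FQ _ FG.
  by split=> //; apply: sub FG _.
- have [K FK [GK HK]] := tF2 _ _ FG FH.
  have [_ K2 _ _] := FQ _ FK.
  have [||e Ke] := K2 a b; first by exists c; apply: GK.
    by exists d; apply: HK.
  by exists e; exists K.
- have [K FK [GK HK]] := tF2 _ _ FG FH.
  have [_ _ K3 _] := FQ _ FK.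
  by apply: (K3 a b); [apply: GK|apply: HK].
- have [K FK [GK HK]] := tF2 _ _ FG FH.
  have [_ _ _ K4] := FQ _ FK.
  by apply: (K4 _ _ _ _ c); [apply: GK|apply: HK].
Qed.

(** A maximal pairing function lives on some [Y]. If the rest of [A] injects into [Y], then [A] has
    the size of [Y]; otherwise [Y] injects into the rest, and the pairing extends to a larger set,
    against maximality. *)
Lemma infinite_card_square : infinite_set A -> A `*` A #<= A.
Proof.
move=> /[dup] /infinite_setN0 A0 /infiniteP /card_le_fun/(_ A0)[u uA uI'].
have uI i j : u i = u j -> i = j by apply: uI'.
pose G0 : set (T * T * T) := [set p | exists i j : nat,
  p = (u i, u j, u (pickle (i, j)))].
have fG0 i : field G0 (u i) by exists (u (pickle (i, i))), i, i.
have QG0 : square_inj G0.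
  split=> [_ _ _ [i [j [-> -> ->]]]|_ _ [_ [i [_ [-> _ _]]]] [_ [j [_ [-> _ _]]]]
    |_ _ _ _ [i [j [-> -> ->]]] [i' [j' [/uI <- /uI <- ->]]]
    |_ _ _ _ _ [i [j [-> -> ->]]] [i' [j' [-> -> /uI/(pcan_inj pickleK)[<- <-]]]]] //.
  by exists (u (pickle (i, j))), i, j.
(* Zorn's lemma also asks for the union of the empty chain, so the empty graph is let in; every
   other graph contains the countable seed [G0]. *)
pose P := [set G | square_inj G /\ (G !=set0 -> G0 `<=` G)].
have [F FP tF|G [[QG GG0] Gmax]] := @Zorn_bigcup _ P.
  split; first by apply: square_inj_bigcup => // G /FP[].
  move=> [p [G FG Gp]] q G0q; exists G => //; have [_ sub] := FP _ FG.
  by apply: sub => //; exists p.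
have {}GG0 : G0 `<=` G.
  apply: GG0; apply/set0P/eqP => G00.
  apply: (Gmax G0); last by split=> // _ q.
  rewrite G00; split=> // /(_ (u 0, u 0, u (pickle (0, 0)))); apply.
  by exists 0, 0.
have Yu i : field G (u i) by have [c /GG0] := fG0 i; exists c.
have [Q1 Q2 Q3 Q4] := QG.
pose Y := field G.
have YA : Y `<=` A by move=> a [c /Q1[]].
have /choice[j' jP'] (p : T * T) : exists c, Y p.1 -> Y p.2 -> G (p.1, p.2, c).
  have [[Ya Yb]|n] := pselect (Y p.1 /\ Y p.2).
    by have [c] := Q2 _ _ Ya Yb; exists c.
  by exists (u 0) => Ya Yb; case: n; split.
pose j a b := j' (a, b).
have jG a b : Y a -> Y b -> G (a, b, j a b) by apply: (jP' (a, b)).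
have jY a b : Y a -> Y b -> Y (j a b) by move=> Ya Yb; case: (Q1 _ _ _ (jG _ _ Ya Yb)).
have jI a b a' b' : Y a -> Y b -> Y a' -> Y b' -> j a b = j a' b' -> a = a' /\ b = b'.
  move=> Ya Yb Ya' Yb' e; apply: (Q4 _ _ _ _ (j a b)); first exact: jG.
  by rewrite e; apply: jG.
have YYY : Y `*` Y #<= Y.
  apply: (@card_le_inj _ _ _ _ (fun p => j p.1 p.2)) => [[a b] [Ya Yb]|].
    exact: jY.
  by move=> [a b] [a' b'] /= [/= Ya Yb] [/= Ya' Yb'] /(jI _ _ _ _ Ya Yb Ya' Yb')[-> ->].
have Y0 : Y !=set0 by exists (u 0); exact: Yu.
have [YAY|AYY] := card_le_total Y (A `\` Y); last first.
  have [e eY eI] := card_le_fun AYY Y0.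
  have AY : A #<= Y.
    pose h a := if pselect (Y a) then j (u 0) a else j (u 1) (e a).
    apply: (@card_le_inj _ _ _ _ h) => [a Aa|a b Aa Ab]; rewrite /h.
      by case: pselect => Ya; apply: jY => //; exact: Yu.
    case: pselect => Ya; case: pselect => Yb.
    - by move=> /(jI _ _ _ _ (Yu 0) Ya (Yu 0) Yb)[].
    - by move=> /(jI _ _ _ _ (Yu 0) Ya (Yu 1) (eY b))[/uI].
    - by move=> /(jI _ _ _ _ (Yu 1) (eY a) (Yu 0) Yb)[/uI].
    - by move=> /(jI _ _ _ _ (Yu 1) (eY a) (Yu 1) (eY b))[_ /eI]; apply.
  have [h hY hI] := card_le_fun AY Y0.
  apply: card_le_trans (card_le_trans YYY (subset_card_le YA)).
  apply: (@card_le_inj _ _ _ _ (fun p => (h p.1, h p.2))) => [p _|[a b] [a' b']].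
    by split; apply: hY.
  by move=> [Aa Ab] [Aa' Ab'] [/hI -> // /hI ->].
exfalso.
have [e eY eI] := card_le_fun YAY (card_le_nonempty YAY Y0).
pose Z := e @` Y; pose W := Y `|` Z.
have /choice[r rP] z : exists y, Z z -> Y y /\ e y = z.
  by have [[y Yy <-]|] := pselect (Z z); [exists y|exists (u 0)].
have ZnY z : Z z -> ~ Y z by move=> [y _ <-]; case: (eY y).
have ZA z : Z z -> A z by move=> [y _ <-]; case: (eY y).
(* The pairs of [W] outside the square of [Y] form three regions, told apart by [tag]; [low] moves
   both coordinates into [Y], and [out] packs them with the tag into the fresh copy [Z]. *)
pose low a := if pselect (Y a) then a else r a.
pose tag a b := if pselect (Y a) then 0 else if pselect (Y b) then 1 else 2.
have lowY a : W a -> Y (low a).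
  by rewrite /low; case: pselect => // nY [//|/rP[]].
have lowI a b : W a -> W b -> (Y a <-> Y b) -> low a = low b -> a = b.
  rewrite /low; case: pselect => Ya; case: pselect => Yb Wa Wb [ab ba] //.
  - by case: Yb; apply: ab.
  - by case: Ya; apply: ba.
  - case: Wa => // /rP[_ ea]; case: Wb => // /rP[_ eb] /= e1.
    by rewrite -ea -eb e1.
pose out a b := e (j (u (tag a b)) (j (low a) (low b))).
have outZ a b : W a -> W b -> Z (out a b).
  move=> Wa Wb; exists (j (u (tag a b)) (j (low a) (low b))) => //.
  by apply: (jY _ _ (Yu _)); apply: jY; apply: lowY.
have outI a b a' b' : W a -> W b -> W a' -> W b' -> ~ (Y a /\ Y b) ->
    ~ (Y a' /\ Y b') -> out a b = out a' b' -> a = a' /\ b = b'.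
  move=> Wa Wb Wa' Wb' n n'.
  have Yl := jY _ _ (lowY _ Wa) (lowY _ Wb).
  have Yl' := jY _ _ (lowY _ Wa') (lowY _ Wb').
  move=> /(eI _ _ (jY _ _ (Yu _) Yl) (jY _ _ (Yu _) Yl')).
  move=> /(jI _ _ _ _ (Yu _) Yl (Yu _) Yl')[/uI et].
  move=> /(jI _ _ _ _ (lowY _ Wa) (lowY _ Wb) (lowY _ Wa') (lowY _ Wb'))[ea eb].
  have [ya yb] : (Y a <-> Y a') /\ (Y b <-> Y b').
    by move: et; rewrite /tag; do 4 case: pselect => //; tauto.
  by split; apply: lowI.
pose G1 := G `|` [set p | exists a b,
  [/\ W a, W b, ~ (Y a /\ Y b) & p = (a, b, out a b)]].
have fW a : field G1 a <-> W a.
  split=> [[c [Gc|[a' [b' [Wa' _ _ [-> _ _]]]]]]|Wa] //; first by left; exists c.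
  have [Ya|nY] := pselect (Y a); first by case: Ya => c Gc; exists c; left.
  by exists (out a a); right; exists a, a; split=> // -[].
have G1Y a b c : Y a -> Y b -> G1 (a, b, c) -> G (a, b, c).
  by move=> Ya Yb [//|[a' [b' [_ _ n [ea eb _]]]]]; case: n; rewrite -ea -eb.
have GW a b c : G (a, b, c) -> [/\ Y a, Y b & Y c] by case/Q1.
apply: (Gmax G1).
  split; first by left.
  have Zu : Z (e (u 0)) by exists (u 0) => //; exact: Yu.
  move=> sub.
  have /GW[] : G (e (u 0), e (u 0), out (e (u 0)) (e (u 0))).
    by apply: sub; right; exists (e (u 0)), (e (u 0)); split=> //; [right|right|move=> [/ZnY]].
  by move/ZnY: Zu.
split; last by move=> _ p /GG0; left.
split.
- move=> a b c [Gabc|[a' [b' [Wa Wb _ [-> -> ->]]]]].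
    have [Aa Ab _ _ _] := Q1 _ _ _ Gabc; have [Ya Yb Yc] := GW _ _ _ Gabc.
    by split=> //; apply/fW; left.
  have WA x : W x -> A x by case=> [/YA|/ZA].
  by split; [apply: WA|apply: WA|apply/fW|apply/fW|apply/fW; right; apply: outZ].
- move=> a b /fW Wa /fW Wb.
  have [[Ya Yb]|n] := pselect (Y a /\ Y b).
    by exists (j a b); left; apply: jG.
  by exists (out a b); right; exists a, b.
- move=> a b c c' [Gc|[a1 [b1 [_ _ n [-> -> ->]]]]] [Gc'|[a2 [b2 [_ _ n' [e1 e2 ->]]]]].
  + exact: Q3 Gc Gc'.
  + by have [Ya Yb _] := GW _ _ _ Gc; case: n'; rewrite -e1 -e2.
  + by have [Ya Yb _] := GW _ _ _ Gc'; case: n.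
  + by rewrite e1 e2.
- move=> a b a' b' c [Gc|[a1 [b1 [W1 W2 n [-> -> ->]]]]].
    move=> [Gc'|[a2 [b2 [W1 W2 n' [_ _ ec]]]]]; first exact: Q4 Gc Gc'.
    have [_ _ Yc] := GW _ _ _ Gc.
    by case: (ZnY c) => //; rewrite ec; apply: outZ.
  move=> [Gc'|[a2 [b2 [W1' W2' n' [-> -> ec]]]]].
    have [_ _ Yc] := GW _ _ _ Gc'.
    by case: (ZnY (out a1 b1)) => //; apply: outZ.
  exact: outI.
Qed.
End infinite_square.

Lemma least_size_exists T (F : set (set T)) : F !=set0 ->
  exists2 A, F A & least_size F A.
Proof.
by move=> /least_card[A FA AP]; exists A => //; split=> //; exists A.
Qed.

Lemma infinite_card_setX_nat T (A : set T) :
  infinite_set A -> A `*` [set: nat] #<= A.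
Proof.
move=> Ainf; have /infiniteP /card_le_fun[|u uA uI] := Ainf.
  exact: infinite_setN0.
apply: card_le_trans (infinite_card_square Ainf).
apply: (@card_le_inj _ _ _ _ (fun p => (p.1, u p.2))) => [[a n] [/= Aa _]|].
  by split.
by move=> [a n] [b m] _ _ [-> /uI ->].
Qed.

Lemma card_fun_nat (T : countType) : [set: T -> nat] #<= [set: nat -> bool].
Proof.
pose code (h : T -> nat) k :=
  if unpickle k is Some (t, n) then h t == n else false.
apply: (@card_le_inj _ _ _ _ code) => // h h' _ _ e; apply: funext => t.
by have := congr1 (fun f => f (pickle (t, h t))) e;
  rewrite /code !pickleK eqxx => /esym /eqP ->.
Qed.

Lemma uncountable_reals : ~ countable [set: nat -> bool].
Proof.
move=> c; have [|u _ uP] := card_le_surj_fun c; first by exists (fun _ => true).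
have [n _ e] := uP (fun n => ~~ u n n) I.
by have := congr1 (fun f => f n) e; case: (u n n).
Qed.

(** Minimality among uncountable sets of reals extends to all types: an uncountable [B] no larger
    than [K] has a copy among the reals. *)
Lemma omega1_exists : exists K : set (nat -> bool), omega1 K.
Proof.
have [|K Kunc Kmin] := @least_card _ [set K : set (nat -> bool) | ~ countable K].
  by exists setT; exact: uncountable_reals.
exists K; split=> // V B Bunc; have [//|BK] := card_le_total K B.
have [|f fK fI] := card_le_fun BK.
  by apply: infinite_setN0 => /finite_set_countable.
have eB : f @` B #= B by apply: inj_card_eq => x y /set_mem Bx /set_mem By; exact: fI.
rewrite -(card_le_eqr eB); apply: Kmin => fBc; apply: Bunc.
by rewrite -(eq_countable eB).
Qed.

(* König's argument: reading [g] as a sequence of reals, one of the countably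
   many sets of [g] having a given rank in their fibre projects onto all reals. *)
Lemma card_ge_reals T (F : set T) (b : (nat -> bool) -> T) :
  (forall g, F (b g)) -> (forall y, countable [set g | b g = y]) ->
  [set: nat -> bool] #<= F.
Proof.
move=> bF bc.
have /choice[e eI] y : exists e : (nat -> bool) -> nat,
    forall g g', b g = y -> b g' = y -> e g = e g' -> g = g'.
  by have [|e _ eI] := card_le_fun (bc y); [exists 0|exists e].
pose d (g : nat -> bool) (i : nat) : nat -> bool := fun j => g (pickle (i, j)).
have [n nP] : exists n, forall h, exists2 g, e (b g) g = n & d g n = h.
  apply: contrapT => no.
  have /choice[h hP] n : exists h, forall g, e (b g) g = n -> d g n <> h.
    apply: contrapT => n1; apply: no; exists n => h; apply: contrapT => n2.
    by apply: n1; exists h => g eg dg; apply: n2; exists g.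
  pose g k := if unpickle k is Some (i, j) then h i j else false.
  apply: (hP (e (b g) g) g) => //; apply: funext => j.
  by rewrite /d /g pickleK.
have /choice[g gP] h : exists g, e (b g) g = n /\ d g n = h.
  by have [g] := nP h; exists g.
apply: (@card_le_inj _ _ _ _ (fun h => b (g h))) => // h h' _ _ eb.
have [eg dg] := gP h; have [eg' dg'] := gP h'.
have gg' : g h = g h' by apply: (eI _ _ _ erefl (esym eb)); rewrite eg eb eg'.
by rewrite -[LHS]dg -[RHS]dg' gg'.
Qed.

(** * Stem-and-bound description of the square topology *)

Lemma quadrant_leq m n a : m <= n -> quadrant n a -> quadrant m a.
Proof. by move=> mn [n1 n2]; split; apply: leq_trans mn _. Qed.

Definition admissible (f : node -> nat) (s t : node) :=
  prefix s t /\
  forall n, size s <= n < size t -> quadrant (f (take n t)) (at0 t n).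

Definition cyl (s : node) (f : node -> nat) : set Xsq :=
  [set x | mkseq x (size s) = s /\
           forall n, size s <= n -> quadrant (f (mkseq x n)) (x n)].

Definition bound_tree (s : node) (f : node -> nat) : set node :=
  [set t | prefix t s \/ admissible f s t].

Lemma take_mkseq T (x : nat -> T) m n : m <= n -> take m (mkseq x n) = mkseq x m.
Proof. by move=> mn; rewrite /mkseq -map_take take_iota; move/minn_idPl: mn => ->. Qed.

Lemma mkseq_recr T (x : nat -> T) n : mkseq x n.+1 = rcons (mkseq x n) (x n).
Proof. by rewrite /mkseq -addn1 iotaD map_cat cats1. Qed.

Lemma take_size_prefix (T : eqType) (s t : seq T) : prefix s t -> take (size s) t = s.
Proof. by rewrite prefixE => /eqP. Qed.

Lemma prefix_size_eq (T : eqType) (s t : seq T) :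
  prefix s t -> size t <= size s -> s = t.
Proof. by move=> p ts; rewrite -(take_size_prefix p) take_oversize. Qed.

Lemma prefix_linear (T : eqType) (s t u : seq T) :
  prefix s u -> prefix t u -> size s <= size t -> prefix s t.
Proof.
move=> /take_size_prefix es /take_size_prefix et st.
by rewrite prefixE -[X in take _ X]et take_takel // es.
Qed.

Lemma admissible_refl f s : admissible f s s.
Proof.
split=> [|n /andP[sn ns]]; first exact: prefix_refl.
by have := leq_trans ns sn; rewrite ltnn.
Qed.

Lemma admissible_rcons f s t a :
  admissible f s t -> quadrant (f t) a -> admissible f s (rcons t a).
Proof.
move=> [st adm] ta; split=> [|n]; first exact: prefix_trans st (prefix_rcons _ _).
rewrite size_rcons ltnS => /andP[sn]; rewrite leq_eqVlt => /orP[/eqP ->|nt].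
  by rewrite -cats1 take_size_cat // nth_cat ltnn subnn.
rewrite nth_rcons nt -cats1 take_cat nt; apply: adm.
by rewrite sn.
Qed.

Lemma admissible_trans f s t u :
  admissible f s t -> admissible f t u -> admissible f s u.
Proof.
move=> [st admt] [tu admu]; split=> [|n /andP[sn nu]]; first exact: prefix_trans tu.
have [tn|nt] := leqP (size t) n; first by apply: admu; rewrite tn.
move/prefixP: tu => [v ->]; rewrite nth_cat nt take_cat nt.
by apply: admt; rewrite sn.
Qed.

Lemma admissible_prefix f s t u :
  admissible f s u -> prefix s t -> prefix t u -> admissible f s t /\ admissible f t u.
Proof.
move=> [su adm] st tu; split; split=> // n /andP[sn nt].
  move/prefixP: tu adm => [v ->] /(_ n).
  rewrite nth_cat nt take_cat nt size_cat; apply.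
  by rewrite sn ltn_addr.
by apply: adm; rewrite nt (leq_trans (size_prefix st) sn).
Qed.

Lemma admissible_mono f g s t :
  (forall u, prefix s u -> f u <= g u) -> admissible g s t -> admissible f s t.
Proof.
move=> fg [st adm]; split=> // n /[dup] /andP[sn nt] /adm.
apply/quadrant_leq/fg/(prefix_linear st (prefix_take _ _)).
by rewrite size_takel // ltnW.
Qed.

Lemma cylP s f x :
  cyl s f x <-> forall n, size s <= n -> admissible f s (mkseq x n).
Proof.
split=> [[es xf] n sn|adm].
  split=> [|m]; first by rewrite prefixE take_mkseq // es.
  rewrite size_mkseq => /andP[sm mn]; rewrite take_mkseq ?(ltnW mn) // nth_mkseq //.
  exact: xf.
split=> [|n sn].
  have [/prefix_size_eq e _] := adm _ (leqnn _).
  by rewrite -e // size_mkseq.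
have [_ /(_ n)] := adm n.+1 (leqW sn).
by rewrite size_mkseq ltnSn sn take_mkseq // nth_mkseq //; apply.
Qed.

Lemma cyl_sub s f t g : admissible f s t -> (forall u, prefix t u -> f u <= g u) ->
  cyl t g `<=` cyl s f.
Proof.
move=> st fg x /cylP xt; apply/cylP => n sn.
have [tn|/ltnW nt] := leqP (size t) n.
  by apply: admissible_trans st _; apply: admissible_mono (xt n tn).
have [tx _] := xt _ (leqnn _).
have e : t = mkseq x (size t) by apply: prefix_size_eq => //; rewrite size_mkseq.
have nt' : prefix (mkseq x n) t by rewrite e prefix_mkseq.
have sx : prefix s (mkseq x n).
  by apply: prefix_linear st.1 nt' _; rewrite size_mkseq.
by have [] := admissible_prefix st sx nt'.
Qed.

(** Coordinate [n] is read off [t n.+1], the first node certain to be longer than [n]. *)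
Lemma branch (t : nat -> node) : (forall k, prefix (t k) (t k.+1)) ->
  (forall k, k <= size (t k)) -> exists x : Xsq, forall k, mkseq x (size (t k)) = t k.
Proof.
move=> pt kt; exists (fun n => at0 (t n.+1) n) => k.
have mono i j : i <= j -> prefix (t i) (t j).
  elim: j => [|j IH]; first by rewrite leqn0 => /eqP ->; exact: prefix_refl.
  rewrite leq_eqVlt => /orP[/eqP ->|/IH h]; first exact: prefix_refl.
  exact: prefix_trans h (pt j).
apply: (@eq_from_nth _ (0, 0)) => [|i]; rewrite size_mkseq // => ik.
rewrite nth_mkseq //.
have [/mono/prefixP[v ->]|/ltnW/mono/prefixP[v ->]] := leqP i.+1 k.
  by rewrite nth_cat (leq_trans _ (kt i.+1)).
by rewrite nth_cat ik.
Qed.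

Lemma branch_cyl s f (t : nat -> node) (x : Xsq) :
  (forall k, k <= size (t k)) -> (forall k, mkseq x (size (t k)) = t k) ->
  (forall k, admissible f s (t k)) -> cyl s f x.
Proof.
move=> kt xt adm; apply/cylP => n sn.
have tn : prefix (mkseq x n) (t n) by rewrite -xt prefix_mkseq.
have sx : prefix s (mkseq x n).
  by apply: prefix_linear (adm n).1 tn _; rewrite size_mkseq.
by have [] := admissible_prefix (adm n) sx tn.
Qed.

Lemma quadrant_diag n : quadrant n (n, n).
Proof. by []. Qed.

Lemma admissible_extend f s n :
  exists2 t, admissible f s t & n <= size t.
Proof.
elim: n => [|n [t st nt]]; first by exists s => //; exact: admissible_refl.
exists (rcons t (f t, f t)); last by rewrite size_rcons.
exact: admissible_rcons st (quadrant_diag _).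
Qed.

Lemma cyl_nonempty s f : cyl s f !=set0.
Proof.
pose t := fix t k := if k is k'.+1 then rcons (t k') (f (t k'), f (t k')) else s.
have adm k : admissible f s (t k).
  elim: k => [|k IH] /=; first exact: admissible_refl.
  exact: admissible_rcons IH (quadrant_diag _).
have kt k : k <= size (t k) by elim: k => //= k; rewrite size_rcons.
have [|x xt] := branch _ kt; first by move=> k; exact: prefix_rcons.
by exists x; apply: branch_cyl adm.
Qed.

Lemma admissible_ind f s (P : node -> Prop) : P s ->
  (forall t a, admissible f s t -> P t -> quadrant (f t) a -> P (rcons t a)) ->
  forall t, admissible f s t -> P t.
Proof.
move=> Ps IH; elim/last_ind => [|t a IHt] sta.
  by have <- : s = [::] by apply: prefix_size_eq => //; case: sta.
have [<- //|ne] := eqVneq s (rcons t a).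
have st : prefix s t.
  apply: prefix_linear sta.1 (prefix_rcons t a) _; rewrite -ltnS -(size_rcons t a).
  rewrite ltn_neqAle size_prefix ?sta.1 // andbT.
  by apply: contra ne => /eqP e; apply/eqP/prefix_size_eq; [exact: sta.1|rewrite e].
have [st' _] := admissible_prefix sta st (prefix_rcons t a).
apply: (IH _ _ st' (IHt st')).
have [_ /(_ (size t))] := sta.
rewrite size_rcons ltnSn size_prefix // => /(_ isT).
by rewrite -cats1 take_size_cat // nth_cat ltnn subnn.
Qed.

Lemma bound_treeP s f : P_square (bound_tree s f).
Proof.
split; first by exists s; left; exact: prefix_refl.
  move=> t u tu [us|us]; first by left; exact: prefix_trans tu us.
  have [ts|st] := leqP (size t) (size s).
    by left; apply: prefix_linear tu us.1 ts.
  right; have st' := prefix_linear us.1 tu (ltnW st).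
  by have [] := admissible_prefix us st' tu.
exists s.
  apply: (@trunk_node_maximal _ _ (f s)).
    split=> [|t [ts|[st _]]]; first by left; exact: prefix_refl.
      by right.
    by left.
  by move=> a sa; right; apply: admissible_rcons sa; exact: admissible_refl.
move=> t [ts|st] pst.
  have -> : t = s by apply: prefix_size_eq => //; exact: size_prefix.
  by exists (f s) => a sa; right; apply: admissible_rcons sa; exact: admissible_refl.
by exists (f t) => a ta; right; apply: admissible_rcons.
Qed.

Lemma bound_tree_sub (T : set node) : P_square T ->
  exists s f, bound_tree s f `<=` T.
Proof.
move=> [_ dT [s [[Ts _] _] qT]].
have /choice[f fP] t : exists N, T t -> prefix s t -> quadrant N `<=` successors T t.
  have [[Tt st]|n] := pselect (T t /\ prefix s t).
    by have [N] := qT t Tt st; exists N.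
  by exists 0 => Tt st; case: n.
exists s, f => t [ts|st]; first exact: dT ts Ts.
apply: (admissible_ind Ts _ st) => {st}t a st Tt; exact: (fP t Tt st.1).
Qed.

Lemma body_bound_tree s f : body (bound_tree s f) = cyl s f.
Proof.
apply/seteqP; split=> [x xT|x xs n].
  apply/cylP => n sn; have [p|//] := xT n.
  have := size_prefix p; rewrite size_mkseq => ns.
  have -> : mkseq x n = s by apply: prefix_size_eq; rewrite ?size_mkseq.
  exact: admissible_refl.
have [sn|ns] := leqP (size s) n; first by right; move/cylP: xs; apply.
by left; rewrite -xs.1 prefix_mkseq // ltnW.
Qed.

Lemma disjointP T (A B : set T) : A `&` B = set0 -> forall x, A x -> ~ B x.
Proof. by move=> AB x Ax Bx; have : (A `&` B) x by []; rewrite AB. Qed.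

Lemma N_squareP A : N_square A <-> forall s f, exists t g,
  admissible f s t /\ cyl t g `&` A = set0.
Proof.
split=> [NA s f|NA T /bound_tree_sub[s [f sfT]]].
  have [S [PS Ssf SA]] := NA _ (bound_treeP s f).
  have [t [g tgS]] := bound_tree_sub PS.
  (* The stem [t] may be shorter than [s]; lengthening it puts it above [s] without leaving [S]. *)
  have [u tu su] := admissible_extend g t (size s).
  exists u, g; split.
    have [p|//] : bound_tree s f u by apply/Ssf/tgS; right.
    have -> : u = s by exact: prefix_size_eq.
    exact: admissible_refl.
  rewrite -subset0 -SA; apply: setSI => x ux n; apply: tgS.
  have : cyl t g x by apply: cyl_sub tu _ _ ux.
  by rewrite -body_bound_tree; apply.
have [t [g [st tgA]]] := NA s f.
pose h u := maxn (f u) (g u).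
exists (bound_tree t h); split; first exact: bound_treeP.
  move=> u ut; apply: sfT; case: ut => [ut|tu].
    have [us|/ltnW su] := leqP (size u) (size s).
      by left; apply: prefix_linear ut st.1 us.
    by right; have [] := admissible_prefix st (prefix_linear st.1 ut su) ut.
  right; apply: admissible_trans st _; apply: admissible_mono tu => v _.
  exact: leq_maxl.
rewrite body_bound_tree -subset0 -tgA; apply: setSI; apply: cyl_sub.
  exact: admissible_refl.
by move=> u _; exact: leq_maxr.
Qed.

Definition null_cover (A : set Xsq) (F : nat -> set Xsq) :=
  (forall n, N_square (F n)) /\ A `<=` \bigcup_n F n.

(** The sets with a countable nowhere dense cover already form a sigma-ideal, so the smallest one is
    no larger. *)
Lemma I_squareP A : I_square A <-> exists F, null_cover A F.
Proof.
split=> [IA|[F [NF AF]] J [[J0 JS JU] NJ]].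
  pose J := [set A | exists F, null_cover A F].
  apply: (IA J); split=> [|B NB]; last first.
    by exists (fun=> B); split=> // x Bx; exists 0.
  split=> [|B C BC [F [NF CF]]|F JF].
  - exists (fun=> set0); split=> [_ T PT|//].
    by exists T; split=> //; rewrite setI0.
  - by exists F; split=> // x /BC/CF.
  - have /choice[G GP] := JF.
    exists (fun k => if unpickle k is Some (n, m) then G n m else G 0 0); split.
      by move=> k; case: unpickle => [[n m]|]; apply: (GP _).1.
    move=> x [n _ Fx]; have [m _ Gx] := (GP n).2 _ Fx.
    by exists (pickle (n, m)) => //; rewrite pickleK.
by apply: JS AF _; apply: JU => n; apply: NJ.
Qed.

Lemma I_square_sigma : sigma_ideal I_square.
Proof.
split=> [J [[//]]|A B AB IB J JJ|F IF J JJ]; have [[_ JS JU] _] := JJ.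
- exact: JS AB (IB J JJ).
- by apply: JU => n; apply: (IF n J JJ).
Qed.

Lemma I_square_N A : N_square A -> I_square A.
Proof. by move=> NA J [_]; apply. Qed.

Lemma I_square_countable_bigcup (G : set (set Xsq)) :
  countable G -> G `<=` I_square -> I_square (\bigcup_(A in G) A).
Proof.
move=> Gc GI; have [I0 Isub IU] := I_square_sigma.
have [->|/set0P G0] := eqVneq G set0; first by rewrite bigcup_set0.
have [u uG uP] := card_le_surj_fun Gc G0.
apply: (Isub _ (\bigcup_n u n)); last by apply: IU => n; apply: GI.
by move=> x [A /uP[n _ <-] Ax]; exists n.
Qed.

(** * Rank analysis and an almost disjoint family of nowhere dense sets *)

(** Positivity with respect to the filter generated by the quadrants. *)
Definition positive (B : set (nat * nat)) := forall N, exists2 a, B a & quadrant N a.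

(** Bounds only grow along the construction, so the branch stays in the cylinder of every stage and
    keeps each requirement [D n] once it is met. *)
Lemma fusion (P : node -> Prop) (D : nat -> node -> (node -> nat) -> Prop) s f :
  P s ->
  (forall n s f, P s -> exists t g,
    [/\ admissible f s t, size s < size t, (forall u, f u <= g u), P t & D n t g]) ->
  exists x, [/\ cyl s f x, forall n, exists2 m, n <= m & P (mkseq x m) &
    forall n, exists t g, D n t g /\ cyl t g x].
Proof.
move=> Ps step.
pose state := (node * (node -> nat))%type.
have /choice[next nextP] (p : nat * state) : exists q : state, P p.2.1 ->
    [/\ admissible p.2.2 p.2.1 q.1, size p.2.1 < size q.1,
        (forall u, p.2.2 u <= q.2 u), P q.1 & D p.1 q.1 q.2].
  have [Pp|nP] := pselect (P p.2.1); last by exists p.2.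
  by have [t [g h]] := step p.1 p.2.1 p.2.2 Pp; exists (t, g).
pose q := fix q k : state := if k is k'.+1 then next (k', q k') else (s, f).
have Pq k : P (q k).1 by elim: k => //= k /(nextP (k, q k))[].
have qS k := nextP (k, q k) (Pq k).
have szq k : k <= size (q k).1.
  by elim: k => // k IH; apply: leq_ltn_trans IH _; case: (qS k).
have q2 k j u : (q k).2 u <= (q (k + j)).2 u.
  elim: j => [|j IH]; first by rewrite addn0.
  by rewrite addnS; apply: leq_trans IH _; case: (qS (k + j)).
have admq k j : admissible (q k).2 (q k).1 (q (k + j)).1.
  elim: j => [|j IH]; first by rewrite addn0; exact: admissible_refl.
  rewrite addnS; apply: admissible_trans IH _.
  by apply: (@admissible_mono _ (q (k + j)).2) => //; case: (qS (k + j)).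
have [k|x xq] := @branch (fun k => (q k).1) _ szq; first by case: (qS k) => -[].
have xcyl k : cyl (q k).1 (q k).2 x.
  apply: (@branch_cyl _ _ (fun j => (q (k + j)).1)) => j.
  - by apply: leq_trans (szq _); exact: leq_addl.
  - exact: xq.
  - exact: admq.
exists x; split=> [|n|n]; first exact: (xcyl 0).
  by exists (size (q n).1) => //; rewrite xq.
by exists (q n.+1).1, (q n.+1).2; split; [case: (qS n)|exact: xcyl].
Qed.

(* [reach B E s]: every branch through [s] that follows [B] meets [E] after
   finitely many steps. *)
Inductive reach (B : node -> set (nat * nat)) (E : set node) : node -> Prop :=
| reach_base s : E s -> reach B E s
| reach_step s : (forall a, B s a -> reach B E (rcons s a)) -> reach B E s.

Lemma eq_reach B B' E s : (forall u, prefix s u -> B u = B' u) ->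
  reach B E s -> reach B' E s.
Proof.
move=> eB rs; elim: rs eB => {s} [s Es eB|s _ IH eB]; first exact: reach_base.
apply: reach_step => a; rewrite -eB ?prefix_refl // => Ba.
by apply: IH => // u ua; apply: eB; apply: prefix_trans ua; exact: prefix_rcons.
Qed.

Definition escape (C : set Xsq) : set node := [set s | exists f, cyl s f `&` C = set0].

(** Call a node good if the conclusion holds at it. A node with a positive set of good successors is
    good, so below a bad node some bound [f] keeps all admissible nodes bad; nowhere density finds
    an escaping, hence good, node among them. *)
Lemma N_square_reach C s : N_square C ->
  exists B, (forall t, positive (B t)) /\ reach B (escape C) s.
Proof.
move=> /N_squareP NC.
pose good := [set s | exists B, (forall t, positive (B t)) /\ reach B (escape C) s].
have goodS t : positive [set a | good (rcons t a)] -> good t.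
  move=> pos.
  have /choice[B BP] a : exists B, (forall t, positive (B t)) /\
      (good (rcons t a) -> reach B (escape C) (rcons t a)).
    have [[B [Bpos rB]]|n] := pselect (good (rcons t a)); first by exists B.
    by exists (fun=> setT); split=> // _ N; exists (N, N).
  (* The families are glued: above [rcons t a] the one picked for [a] is used, with [a] recovered as
     entry [size t] of the node. *)
  exists (fun u => if size u <= size t then [set a | good (rcons t a)]
                   else B (at0 u (size t)) u); split=> [u|].
    by case: ifP => // _; apply: (BP _).1.
  apply: reach_step => a; rewrite leqnn => /(BP a).2; apply: eq_reach => u.
  move=> /prefixP[v ->]; rewrite size_cat size_rcons addSn ltnNge leq_addr /=.
  by rewrite nth_cat size_rcons ltnSn nth_rcons ltnn eqxx.
apply: contrapT => /= bad.
have /choice[f fP] t : exists N, ~ good t -> forall a, quadrant N a -> ~ good (rcons t a).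
  have [gt|ngt] := pselect (good t); first by exists 0.
  apply: contrapT => no; apply: ngt; apply: goodS => N; apply: contrapT => no2.
  by apply: no; exists N => _ a qa ga; apply: no2; exists a.
have [t [g [st tg]]] := NC s f.
have : ~ good t.
  by apply: (@admissible_ind f s (fun t => ~ good t)) => // u a _ nu; exact: fP.
apply; exists (fun=> setT); split; first by move=> _ N; exists (N, N).
by apply: reach_base; exists g.
Qed.

(** Each step demanded by the recursion can be taken outside [A] and beyond the bound, because [B t]
    minus [A] is still positive. *)
Lemma reach_avoid B E A s f : (forall t, positive (B t `\` A)) -> reach B E s ->
  {in s, forall a, ~ A a} ->
  exists t, [/\ admissible f s t, E t & {in t, forall a, ~ A a}].
Proof.
move=> Bpos; elim=> {s} [s Es As|s _ IH As].
  by exists s; split=> //; exact: admissible_refl.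
have [a [Ba Aa] qa] := Bpos s (f s).
have [|t [at' Et At]] := IH a Ba.
  by move=> b; rewrite mem_rcons inE => /orP[/eqP ->|/As].
exists t; split=> //; apply: admissible_trans at'.
by apply: admissible_rcons qa; exact: admissible_refl.
Qed.

Definition avoiding (A : set (nat * nat)) : set Xsq := [set x | forall n, ~ A (x n)].

(** Distinct reals share only finitely many initial segments, which gives almost disjointness;
    placing the codes on the diagonal makes them meet every quadrant. *)
Definition initial_codes (g : nat -> bool) : set (nat * nat) :=
  [set a | a.1 = a.2 /\ exists k, a.1 = pickle (mkseq g k)].

Lemma avoiding_codes_N g : N_square (avoiding (initial_codes g)).
Proof.
apply/N_squareP => s f.
have inj_code : injective (fun k => pickle (mkseq g k)).
  by move=> j k /(pcan_inj pickleK) /(congr1 size); rewrite !size_mkseq.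
have [k fk] := injective_gtn inj_code (f s).
set m := pickle _ in fk.
exists (rcons s (m, m)), f; split.
  by apply: admissible_rcons; [exact: admissible_refl|split; exact: ltnW].
apply/seteqP; split=> // x [[e _] nA]; apply: (nA (size s)).
move: e; rewrite size_rcons mkseq_recr => /rcons_inj[_ ->]; split=> //; by exists k.
Qed.

Lemma initial_codes_almost_disjoint B g h : positive B ->
  ~ positive (B `\` initial_codes g) -> ~ positive (B `\` initial_codes h) -> g = h.
Proof.
move=> Bpos ng nh; apply: funext => i; apply: contrapT => ghi.
have ev g' : ~ positive (B `\` initial_codes g') ->
    exists N, forall a, B a -> quadrant N a -> initial_codes g' a.
  move=> n; apply: contrapT => no; apply: n => N; apply: contrapT => no2.
  apply: no; exists N => a Ba qa; apply: contrapT => na.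
  by apply: no2; exists a.
have [N NP] := ev _ ng; have [N' NP'] := ev _ nh.
(* A code above [M] belongs to a segment longer than [i], and a common segment of that length forces
   [g i = h i]. *)
pose M := \max_(k < i.+1) pickle (mkseq g k).
have [a Ba qa] := Bpos (maxn N (maxn N' M.+1)).
have [||_ [k ek]] := NP a => //; first by apply: quadrant_leq qa; rewrite leq_maxl.
have [||_ [k' ek']] := NP' a => //.
  by apply: quadrant_leq qa; rewrite !leq_max leqnn orbT.
have : quadrant M.+1 a.
  by apply: quadrant_leq qa; rewrite !leq_max leqnn !orbT.
have e : mkseq g k = mkseq h k' by apply: (pcan_inj pickleK); rewrite -ek.
have kk' : k = k' by have := congr1 size e; rewrite !size_mkseq.
have [ik|ki] := leqP i.+1 k.
  case: ghi; have := congr1 (fun s => nth false s i) e.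
  by rewrite -kk' !nth_mkseq.
rewrite /quadrant /= ek => -[+ _]; rewrite ltnNge => /negP; apply.
exact: (@leq_bigmax _ (fun k : 'I_i.+1 => pickle (mkseq g k)) (Ordinal ki)).
Qed.

(** If removing [initial_codes g] leaves every set [B p t] positive, fusion yields a branch that
    avoids these codes and escapes every [C n], hence lies outside [A]. So each [g] in question
    spoils some [B p t], and by almost disjointness each of these countably many sets is spoiled by
    at most one [g]. *)
Lemma countable_avoiding A : I_square A ->
  countable [set g | avoiding (initial_codes g) `<=` A].
Proof.
move=> /I_squareP[C [NC AC]].
have /choice[B BP] (p : nat * node) : exists B, (forall t, positive (B t)) /\
    reach B (escape (C p.1)) p.2 by exact: N_square_reach.
have bad g : avoiding (initial_codes g) `<=` A ->
    exists p : nat * node * node, ~ positive (B p.1 p.2 `\` initial_codes g).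
  move=> gA; apply: contrapT => no.
  have pos p t : positive (B p t `\` initial_codes g).
    by apply: contrapT => np; apply: no; exists (p, t).
  pose P (s : node) := {in s, forall a, ~ initial_codes g a}.
  pose D n t h := cyl t h `&` C n = set0.
  have [//|n s f Ps|x [_ xP xD]] := @fusion P D [::] (fun=> 0).
    have [t [st [h thC] Pt]] := reach_avoid f (pos (n, s)) (BP (n, s)).2 Ps.
    (* [reach_avoid] may return [s] itself, so one more step, obeying both bounds, guarantees
       growth. *)
    have [a [_ Aa] qa] := pos (n, s) t (maxn (f t) (h t)).
    exists (rcons t a), (fun u => maxn (f u) (h u)); split.
    - by apply: admissible_rcons st (quadrant_leq _ qa); exact: leq_maxl.
    - by rewrite size_rcons ltnS size_prefix //; case: st.
    - by move=> u; exact: leq_maxl.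
    - by move=> b; rewrite mem_rcons inE => /orP[/eqP ->|/Pt].
    - rewrite /D -subset0 -thC; apply: setSI; apply: cyl_sub => [|u _]; last exact: leq_maxr.
      apply: admissible_rcons (quadrant_leq _ qa); last exact: leq_maxr.
      exact: admissible_refl.
  have /gA/AC[n _ Cx] : avoiding (initial_codes g) x.
    move=> n; have [m nm Pm] := xP n.+1; apply: Pm.
    by apply/mapP; exists n => //; rewrite mem_iota.
  by have [t [h [/disjointP dis /dis]]] := xD n.
have /choice[p pP] g : exists p : nat * node * node,
    avoiding (initial_codes g) `<=` A -> ~ positive (B p.1 p.2 `\` initial_codes g).
  by have [/bad[p]|] := pselect (avoiding (initial_codes g) `<=` A);
    [exists p|exists (0, [::], [::])].
apply: (@sub_countable _ _ _ [set: nat * node * node]); last exact: countableP.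
apply: (@card_le_inj _ _ _ _ p) => // g h gA hA e.
apply: (@initial_codes_almost_disjoint (B (p g).1 (p g).2)).
- exact: (BP _).1.
- exact: pP.
- by rewrite e; apply: pP.
Qed.

Lemma I_square_proper : ~ I_square setT.
Proof.
move=> /countable_avoiding; set S := [set _ | _].
have -> : S = setT by rewrite -subTset => g _ x _.
exact: uncountable_reals.
Qed.

Lemma add_I_square : add_ideal I_square =c omega1.
Proof.
have [K K1] := omega1_exists; have [Kunc Kmin] := K1.
pose F := (fun g => avoiding (initial_codes g)) @` K.
have uncountable_add G : G `<=` I_square -> ~ I_square (\bigcup_(A in G) A) -> ~ countable G.
  by move=> GI nG Gc; apply: nG; exact: I_square_countable_bigcup.
have FI : F `<=` I_square.
  by move=> _ [g _ <-]; exact: I_square_N (@avoiding_codes_N g).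
have FU : ~ I_square (\bigcup_(A in F) A).
  move=> /countable_avoiding c; apply: Kunc; apply: sub_countable c.
  by apply: subset_card_le => g Kg x xg; exists (avoiding (initial_codes g)) => //; exists g.
exists (nat -> bool)%type, K; split=> //; split.
  exists F; first by split.
  by rewrite card_eq_le card_image_le; apply: Kmin; apply: uncountable_add.
by move=> G [GI GU]; apply: Kmin; apply: uncountable_add.
Qed.

Lemma cof_I_square : cof_ideal I_square =c continuum.
Proof.
have lower F : (forall A, I_square A -> exists2 B, F B & A `<=` B) ->
    F `<=` I_square -> [set: nat -> bool] #<= F.
  move=> cofF FI.
  have /choice[b bP] g : exists B, F B /\ avoiding (initial_codes g) `<=` B.
    have [B FB sub] := cofF _ (I_square_N (@avoiding_codes_N g)).
    by exists B.
  apply: (@card_ge_reals _ _ b) => [g|y]; first by case: (bP g).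
  have [[g0 _ <-]|n] := pselect (range b y); last first.
    by rewrite (_ : [set g | _] = set0) // -subset0 => g /= e; apply: n; exists g.
  apply: sub_countable (countable_avoiding (FI _ (bP g0).1)).
  by apply: subset_card_le => g /= <-; case: (bP g).
(* For each [n] and [s], the entry at [None] is a flag telling whether a cylinder with stem [s] is
   removed from piece [n], and the entries at [Some u] are its bound. There are only continuum many
   codes. *)
pose code := (nat * (node * option node) -> nat)%type.
pose piece (c : code) n : set Xsq := [set x | forall s, c (n, (s, None)) = 1 ->
  ~ cyl s (fun u => c (n, (s, Some u))) x].
pose M c := \bigcup_n piece c n.
pose F := M @` [set c | I_square (M c)].
have FI : F `<=` I_square by move=> _ [c Mc <-].
have cofF A : I_square A -> exists2 B, F B & A `<=` B.
  move=> /I_squareP[C [NC AC]].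
  have /choice[f fP] (p : nat * node) : exists f, escape (C p.1) p.2 ->
      cyl p.2 f `&` C p.1 = set0.
    by have [[f]|] := pselect (escape (C p.1) p.2); [exists f|exists (fun=> 0)].
  pose c : code := fun q => if q.2.2 is Some u then f (q.1, q.2.1) u
    else `[< escape (C q.1) q.2.1 >].
  have cE n s : c (n, (s, None)) = 1 -> escape (C n) s.
    by rewrite /c /=; case: asboolP.
  have NM n : N_square (piece c n).
    apply/N_squareP => s g; have [t [h [st thC]]] := (N_squareP _).1 (NC n) s g.
    have Et : escape (C n) t by exists h.
    exists t, (f (n, t)); split=> //; rewrite -subset0 => x [tx /(_ t)]; apply=> //.
    by rewrite /c /= asboolT.
  have IM : I_square (M c) by apply/I_squareP; exists (piece c); split.
  exists (M c); first by exists c.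
  move=> x /AC[n _ Cx]; exists n => // s /cE Es xs.
  by have /disjointP dis := fP (n, s) Es; exact: dis xs Cx.
have eF : F #= [set: nat -> bool].
  rewrite card_eq_le lower // andbT.
  apply: card_le_trans (card_image_le _ _) _.
  by apply: card_le_trans (card_leT _) _; exact: card_fun_nat.
exists _, F; split=> //; split; first by exists F.
by move=> G [GI Gcof]; rewrite (card_le_eql eF); exact: lower.
Qed.

(** * Meager subsets of the Cantor space *)

(** The sets on the right form a filter; its convergence to [z] in each coordinate gives one
    direction, and finite intersections of open coordinate conditions give the other. *)
Lemma cantor_nbhsP (z : cantor_space) (A : set cantor_space) :
  nbhs z A <-> exists n, forall y : cantor_space, (forall i, i < n -> z i = y i) -> A y.
Proof.
split=> [|[n nA]].
  pose F : set_system cantor_space := [set A : set cantor_space | exists n,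
    forall y : cantor_space, (forall i, i < n -> z i = y i) -> A y].
  have FF : Filter F.
    split=> [|B C [n nB] [m mC]|B C BC [n nB]]; first by exists 0.
      exists (maxn n m) => y zy; split; [apply: nB|apply: mC] => i im;
        by apply: zy; rewrite leq_max im ?orbT.
    by exists n => y /nB /BC.
  have : F --> z; last exact.
  apply/cvg_sup => i; apply/cvg_image.
    by apply/seteqP; split=> // b _; exists (fun=> b).
  move=> B /nbhs_singleton Bz.
  exists [set y : cantor_space | B (y i)].
    by exists i.+1 => y /(_ i (ltnSn i)) /= <-.
  apply/seteqP; split=> [_ [y By <-] //|b Bb].
  by exists (fun=> b).
have tree_prefix : nbhs z [set y : cantor_space | forall i, i < n -> z i = y i].
  elim: n {nA} => [|n IH]; first by apply: filterS filterT.
  have nz : nbhs z (proj n @^-1` [set z n] : set cantor_space).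
    exists (proj n @^-1` [set z n]); split=> //.
    suff : @open cantor_space (proj n @^-1` [set z n]) by [].
    by apply: open_comp; [move=> + _; exact: proj_continuous|apply: discrete_open].
  apply: filterS (filterI IH nz) => y [zy yn] i.
  by rewrite ltnS leq_eqVlt => /orP[/eqP ->|/zy].
by apply: filterS tree_prefix => y; exact: nA.
Qed.

Definition starts (s : seq bool) (z : nat -> bool) := mkseq z (size s) = s.

Lemma starts_cat s t z : starts (s ++ t) z <->
  starts s z /\ mkseq (fun i => z (size s + i)) (size t) = t.
Proof.
rewrite /starts /mkseq size_cat iotaD map_cat add0n.
rewrite -[X in iota X (size t)]addn0 iotaDl -map_comp; split=> [/eqP|[-> ->] //].
by rewrite eqseq_cat ?size_map ?size_iota // => /andP[/eqP -> /eqP].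
Qed.

Lemma starts_mkseq z n y : starts (mkseq z n) y <-> forall i, i < n -> z i = y i.
Proof.
rewrite /starts size_mkseq; split=> [e i ni|e].
  by have := congr1 (fun s => nth false s i) e; rewrite !nth_mkseq.
apply: (@eq_from_nth _ false) => [|i]; rewrite !size_mkseq // => ni.
by rewrite !nth_mkseq // e.
Qed.

Lemma starts_nth s y : starts s y <-> forall i, i < size s -> nth false s i = y i.
Proof. by rewrite -starts_mkseq mkseq_nth. Qed.

Lemma nowhere_denseP (F : set cantor_space) :
  nowhere_dense F <-> forall s, exists t, forall z, starts (s ++ t) z -> ~ F z.
Proof.
rewrite /nowhere_dense; split=> [F0 s|Fs].
  pose x : cantor_space := fun i => nth false s i.
  have [y [sy yF]] : exists y : cantor_space, starts s y /\ ~ closure F y.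
    apply: contrapT => no.
    have : interior (closure F) x; last by rewrite F0.
    apply/cantor_nbhsP; exists (size s) => y xy; apply: contrapT => ny.
    by apply: no; exists y; split=> //; apply/starts_nth.
  have [n nF] : exists n, forall z, starts (mkseq y n) z -> ~ F z.
    apply: contrapT => no; apply: yF => B /cantor_nbhsP[n nB].
    apply: contrapT => no2; apply: no; exists n => z /starts_mkseq yz Fz.
    by apply: no2; exists z; split=> //; apply: nB.
  exists (mkseq (fun i => y (size s + i)) (n - size s)) => z sz; apply: nF.
  apply/starts_mkseq => i ni; move/starts_nth: sz => /(_ i).
  rewrite size_cat size_mkseq nth_cat; have [si|si] := ltnP i (size s).
    by rewrite ltn_addr // => /(_ isT) <-; move/starts_nth: sy => /(_ i si).
  have [h1 h2] : i < size s + (n - size s) /\ i - size s < n - size s.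
    by rewrite -maxnE leq_max ni orbT ltn_sub2r // (leq_ltn_trans si).
  by rewrite h1 nth_mkseq // subnKC // => /(_ isT).
apply/seteqP; split=> // x /cantor_nbhsP[n nF].
have [t tF] := Fs (mkseq x n).
pose y : cantor_space := fun i => nth false (mkseq x n ++ t) i.
have : closure F y.
  apply: nF => i ni; rewrite /y nth_cat size_mkseq ni nth_mkseq //.
move=> /(_ [set z | starts (mkseq x n ++ t) z]) [|z [Fz /tF]] //.
apply/cantor_nbhsP; exists (size (mkseq x n ++ t)) => z yz.
by apply/starts_nth => i ni; rewrite -yz.
Qed.

Definition occurs (w : nat -> seq bool) (z : nat -> bool) m :=
  mkseq (fun i => z (m + i)) (size (w m)) = w m.

(** One word [w m] serves all strings of length [m] and the first [m.+1] nowhere dense sets at once,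
    since these finitely many tasks are met by successive extension. *)
Lemma meager_code (A : set cantor_space) : meager A ->
  exists w, forall z, A z -> exists N, forall m, N <= m -> ~ occurs w z m.
Proof.
move=> [F Fnd ->].
have ext (L : seq (seq bool * nat)) : exists w, forall s i, (s, i) \in L ->
    forall z, starts (s ++ w) z -> ~ F i z.
  elim: L => [|[s i] L [w wL]]; first by exists [::].
  have [t tF] := (nowhere_denseP _).1 (Fnd i) (s ++ w).
  exists (w ++ t) => s' i'; rewrite inE => /orP[/eqP[-> ->]|/wL h] z; rewrite catA.
    exact: tF.
  by move=> /starts_cat[+ _]; apply: h.
have /choice[w wP] m : exists w, forall s i, size s = m -> i <= m ->
    forall z, starts (s ++ w) z -> ~ F i z.
  have [w wL] := ext [seq (val s, i) | s <- enum {: m.-tuple bool}, i <- iota 0 m.+1].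
  exists w => s i sm im; apply: wL; apply/allpairsP.
  move/eqP: sm => sm; exists (Tuple sm, i).
  by rewrite mem_enum mem_iota.
exists w => z [i _ Fz]; exists i => m im wz.
apply: (wP m (mkseq z m) i _ im z) => //; first by rewrite size_mkseq.
apply/starts_cat; split; first by rewrite /starts size_mkseq.
by rewrite size_mkseq.
Qed.

(** For increasing [I], this is the standard combinatorial form of a meager set: the reals that
    match the chopped real [(v, I)] only finitely often. *)
Definition blockwise_differ (v : nat -> bool) (I : nat -> nat) : set cantor_space :=
  [set z | exists J, forall j, J <= j -> exists2 i, I j <= i < I j.+1 & z i <> v i].

Lemma meager_blockwise_differ v I : (forall j, I j < I j.+1) ->
  meager (blockwise_differ v I).
Proof.
move=> I_incr.
exists (fun J => [set z : cantor_space | forall j, J <= j ->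
    exists2 i, I j <= i < I j.+1 & z i <> v i]); last first.
  by apply/seteqP; split=> [z [J zJ]|z [J _ zJ]]; exists J.
move=> J; apply/nowhere_denseP => s.
have leI j : j <= I j by elim: j => // j IH; exact: leq_ltn_trans IH (I_incr j).
(* Block [j] starts past [s], so copying [v] from position [size s] to the end of the block makes
   the whole block agree. *)
pose j := maxn J (size s).
have sI : size s <= I j by apply: leq_trans (leI j); rewrite leq_maxr.
exists (mkseq (fun i => v (size s + i)) (I j.+1 - size s)) => z /starts_cat[_ e].
move=> /(_ j (leq_maxl _ _))[i /andP[Ii iI]]; apply.
have si := leq_trans sI Ii.
have := congr1 (fun t => nth false t (i - size s)) e.
have h : i - size s < I j.+1 - size s by rewrite ltn_sub2r // (leq_ltn_trans si).
by rewrite size_mkseq !nth_mkseq // subnKC.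
Qed.

(** * From the square ideal to the meager ideal *)

(* The discarded second component makes every string the decoding of arbitrarily
   large numbers. *)
Definition decode (n : nat) : seq bool :=
  if (unpickle n : option (seq bool * nat)) is Some (w, _) then w else [::].

Lemma decode_cofinal w N : exists2 n, N <= n & decode n = w.
Proof.
have inj_w : injective (fun i : nat => pickle (w, i)).
  by move=> i j /(pcan_inj pickleK)[].
have [i Ni] := injective_gtn inj_w N.
by exists (pickle (w, i)); [exact: ltnW|rewrite /decode pickleK].
Qed.

(** The closing letter [false] makes every step contribute, so [cohen_real] is determined everywhere
    even if the decoded words are empty. *)
Definition letters (t : node) : seq bool :=
  flatten [seq rcons (decode a.2) false | a <- t].

Definition cohen_real (x : Xsq) (i : nat) : bool :=
  nth false (letters (mkseq x i.+1)) i.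

(** The successor in each summand makes the block boundaries strictly increasing; since the marker
    depends on the node alone, it may enter a bound. *)
Definition marker (t : node) : nat := sumn [seq a.1.+1 | a <- t].

Definition blocks (x : Xsq) (j : nat) : nat := marker (mkseq x j).

Lemma size_letters t : size t <= size (letters t).
Proof.
elim: t => //= a t IH; rewrite /letters /= size_cat size_rcons addSn ltnS.
by apply: leq_trans IH _; exact: leq_addl.
Qed.

Lemma letters_cat s t : letters (s ++ t) = letters s ++ letters t.
Proof. by rewrite /letters map_cat flatten_cat. Qed.

Lemma cohen_realE x n i : i < size (letters (mkseq x n)) ->
  cohen_real x i = nth false (letters (mkseq x n)) i.
Proof.
have pre j k : j <= k -> exists u, letters (mkseq x k) = letters (mkseq x j) ++ u.
  by move=> /prefix_mkseq-/(_ x)/prefixP[u ->]; exists (letters u); rewrite letters_cat.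
move=> ni; rewrite /cohen_real.
have [/pre[u ->]|/ltnW/pre[u ->]] := leqP i.+1 n.
  by rewrite nth_cat (leq_trans _ (size_letters _)) // size_mkseq.
by rewrite nth_cat ni.
Qed.

Lemma occurs_cohen_real w x n :
  decode (x n).2 = w (size (letters (mkseq x n))) ->
  occurs w (cohen_real x) (size (letters (mkseq x n))).
Proof.
set m := size _ => xw; rewrite /occurs.
apply: (@eq_from_nth _ false) => [|i]; rewrite size_mkseq // => im.
have e : letters (mkseq x n.+1) = letters (mkseq x n) ++ rcons (w m) false.
  by rewrite mkseq_recr -cats1 letters_cat /letters /= cats0 xw.
rewrite nth_mkseq // (@cohen_realE _ n.+1) e.
  by rewrite nth_cat ltnNge leq_addr /= addKn nth_rcons im.
by rewrite size_cat ltn_add2l size_rcons ltnS ltnW.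
Qed.

(** A second coordinate above any bound can decode to the word required at the current position, so
    one admissible step creates an occurrence. *)
Lemma I_square_not_occurs w :
  I_square [set x | exists N, forall m, N <= m -> ~ occurs w (cohen_real x) m].
Proof.
apply/I_squareP; exists (fun N => [set x | forall m, N <= m -> ~ occurs w (cohen_real x) m]).
split=> [N|x [N xN]]; last by exists N.
apply/N_squareP => s f.
have [t st Nt] := admissible_extend f s N.
have [j fj jw] := decode_cofinal (w (size (letters t))) (f t).
exists (rcons t (f t, j)), f; split; first exact: admissible_rcons.
apply/seteqP; split=> // x [[]]; rewrite size_rcons mkseq_recr => /rcons_inj[xt xj] _.
move=> /(_ (size (letters t))); apply.
  by apply: leq_trans (size_letters _).
rewrite -{1}xt; apply: occurs_cohen_real.
by rewrite xj xt.
Qed.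

(** Raising the bound at each node [t] to at least [g (marker t)] rules out every violation beyond
    the stem. *)
Lemma N_square_below g :
  N_square [set x | forall J, exists2 j, J <= j & (x j).1 < g (blocks x j)].
Proof.
apply/N_squareP => s f.
exists s, (fun t => maxn (f t) (g (marker t))); split; first exact: admissible_refl.
apply/seteqP; split=> // x [[_ xf] /(_ (size s))[j sj]].
have [+ _] := xf j sj; rewrite geq_max => /andP[_ h].
by rewrite ltnNge h.
Qed.

Lemma blocks_incr x j : blocks x j.+1 = (blocks x j + (x j).1).+1.
Proof.
by rewrite /blocks mkseq_recr /marker map_rcons sumn_rcons addnS.
Qed.

(** The Cohen real of [x] contains words of the code at arbitrarily large positions, and the
    dominating [x'] makes almost every block long enough to hold such an occurrence whole. A real of
    [A] eventually misses these words, so it differs from the Cohen real inside the block. The set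
    [C'] depends on [x] because the function to dominate does. *)
Lemma square_captures_meager (A : set cantor_space) : meager A ->
  exists2 C, I_square C & forall x, ~ C x ->
  exists2 C', I_square C' & forall x', ~ C' x' ->
  A `<=` blockwise_differ (cohen_real x) (blocks x').
Proof.
move=> /meager_code[w wA].
eexists; first exact: (I_square_not_occurs w).
move=> x xw.
(* [g m] is at or past the end of some occurrence that starts at [m] or later. *)
have /choice[g gP] m : exists n m', [/\ m <= m', occurs w (cohen_real x) m' &
    m' + size (w m') <= n].
  apply: contrapT => no; apply: xw; exists m => m' mm' occ; apply: no.
  by exists (m' + size (w m')), m'.
eexists; first by apply: I_square_N; exact: (N_square_below g).
move=> x' xg z Az.
have [J JP] : exists J, forall j, J <= j -> g (blocks x' j) <= (x' j).1.
  apply: contrapT => no; apply: xg => J; apply: contrapT => no2; apply: no.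
  by exists J => j Jj; rewrite leqNgt; apply/negP => h; apply: no2; exists j.
have [N NP] := wA z Az.
exists (maxn J N) => j; rewrite geq_max => /andP[Jj Nj].
have [m [bm occ mn]] := gP (blocks x' j).
have jb : j <= blocks x' j.
  by elim: j {Jj Nj bm occ mn m} => // j IH; rewrite blocks_incr ltnS (leq_trans IH) // leq_addr.
have Nm : N <= m by apply: leq_trans Nj (leq_trans jb bm).
apply: contrapT => no; apply: (NP m Nm); rewrite /occurs -[RHS]occ.
apply: (@eq_from_nth _ false) => [|i]; rewrite !size_mkseq // => im.
rewrite !nth_mkseq //; apply: contrapT => ne; apply: no; exists (m + i) => //.
rewrite (leq_trans bm (leq_addr _ _)) blocks_incr ltnS.
apply: leq_trans (leq_trans (leq_trans mn (JP j Jj)) (leq_addl _ _)).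
by rewrite leq_add2l ltnW.
Qed.

(** A code for the whole space would be missed by every [cohen_real x] from some point on, which
    puts all of [Xsq] into the ideal. *)
Lemma cantor_not_meager : ~ meager [set: cantor_space].
Proof.
move=> /meager_code[w wP]; apply: I_square_proper.
have [_ Isub _] := I_square_sigma; apply: Isub (I_square_not_occurs w) => x _.
exact: wP.
Qed.

Lemma meager1 (z : cantor_space) : meager [set z].
Proof.
exists (fun=> [set z]); last by apply/seteqP; split=> [y yz|y []//]; exists 0.
move=> _; apply/nowhere_denseP => s; exists [:: ~~ z (size s)] => y /starts_nth e yz.
move: (e (size s)); rewrite size_cat addn1 ltnSn nth_cat ltnn subnn yz => /(_ isT).
by case: (z (size s)).
Qed.

Lemma meagerS (A B : set cantor_space) : A `<=` B -> meager B -> meager A.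
Proof.
move=> AB [F Fnd eB]; exists (fun n => F n `&` A).
  move=> n; apply/nowhere_denseP => s; have [t tF] := (nowhere_denseP _).1 (Fnd n) s.
  by exists t => z /tF nF [].
by rewrite -setI_bigcupl -eB; apply/seteqP; split=> [x Ax|x []//]; split=> //; exact: AB.
Qed.

Lemma meager_blocks x x' : meager (blockwise_differ (cohen_real x) (blocks x')).
Proof. by apply: meager_blockwise_differ => j; rewrite blocks_incr ltnS leq_addr. Qed.

Lemma I_square1 x : I_square [set x].
Proof.
apply: I_square_N; apply/N_squareP => s f.
pose k := maxn (f s) (x (size s)).1.+1.
exists (rcons s (k, k)), f; split.
  apply: admissible_rcons; first exact: admissible_refl.
  by apply: (@quadrant_leq _ k) => //; exact: leq_maxl.
apply/seteqP; split=> // y [[e _] yx]; move: e.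
rewrite size_rcons mkseq_recr yx => /rcons_inj[_ e].
by have := leq_maxr (f s) (x (size s)).1.+1; rewrite -/k e ltnn.
Qed.

Lemma cov_family : [set F | F `<=` I_square /\ \bigcup_(A in F) A = setT] !=set0.
Proof.
exists (range (fun x : Xsq => [set x])); split=> [_ [x _ <-]|].
  exact: I_square1.
by rewrite -subTset => x _; exists [set x].
Qed.

(** Take a least family of meager sets with nonmeager union. If the exceptional sets [C] omit some
    [x], and the sets [C'] for that [x] omit some [x'], then a single meager set contains the whole
    union; hence one of the two families covers. *)
Lemma cov_I_square_le_add_meager :
  cov_ideal I_square <=c add_ideal (@meager cantor_space).
Proof.
have [L LF Lmin] := least_size_exists cov_family.
have [|K KF Kmin] := @least_size_exists _ [set F : set (set cantor_space) |
    F `<=` @meager cantor_space /\ ~ meager (\bigcup_(A in F) A)].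
  exists (range (fun z : cantor_space => [set z])); split=> [_ [z _ <-]|].
    exact: meager1.
  move=> h; apply: cantor_not_meager; move: h; apply: meagerS => z _.
  by exists [set z].
exists _, L, _, K; split=> //.
have [KM nK] := KF.
have /choice[phi phiP] A : exists C, meager A -> I_square C /\ forall x, ~ C x ->
  exists2 C', I_square C' & forall x', ~ C' x' ->
  A `<=` blockwise_differ (cohen_real x) (blocks x').
  by have [/square_captures_meager[C IC CP]|] := pselect (meager A);
    [exists C|exists set0].
have [covered|] := pselect (\bigcup_(C in phi @` K) C = setT).
  apply: card_le_trans (card_image_le phi K); apply: Lmin.2; split=> //.
  by move=> _ [A KA <-]; case: (phiP A (KM A KA)).
rewrite -subTset => /existsNP[x /not_implyP[_ nx]].
have /choice[phi' phi'P] A : exists C', K A -> I_square C' /\ forall x', ~ C' x' ->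
  A `<=` blockwise_differ (cohen_real x) (blocks x').
  have [KA|] := pselect (K A); last by exists set0.
  have [_ /(_ x)[|C' IC' C'P]] := phiP A (KM A KA); last by exists C'.
  by move=> Cx; apply: nx; exists (phi A) => //; exists A.
have [covered|] := pselect (\bigcup_(C in phi' @` K) C = setT).
  apply: card_le_trans (card_image_le phi' K); apply: Lmin.2; split=> //.
  by move=> _ [A KA <-]; case: (phi'P A KA).
rewrite -subTset => /existsNP[x' /not_implyP[_ nx']]; case: nK.
apply: meagerS (meager_blocks x x') => z [A KA Az].
have [_ /(_ x')] := phi'P A KA; apply=> // Cx'.
by apply: nx'; exists (phi' A) => //; exists A.
Qed.

Lemma non_family : [set A | ~ I_square A] !=set0.
Proof. by exists setT; exact: I_square_proper. Qed.

Lemma non_I_square_infinite D : ~ I_square D -> infinite_set D.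
Proof.
move=> nD /finite_set_countable Dc; apply: nD.
rewrite (_ : D = \bigcup_(A in set1 @` D) A); last first.
  by rewrite bigcup_image; apply/seteqP; split=> [x Dx|x [y Dy ->//]]; exists x.
apply: I_square_countable_bigcup => [|_ [x _ <-]]; last exact: I_square1.
exact: sub_countable (card_image_le _ _) Dc.
Qed.

(** Pairs from a set [D] outside the ideal index a cofinal family of meager sets, and the infinite
    [D] has no more pairs than points. *)
Lemma cof_meager_le_non_I_square :
  cof_ideal (@meager cantor_space) <=c non_ideal I_square.
Proof.
have [D nD Dmin] := least_size_exists non_family.
have [|K KF Kmin] := @least_size_exists _ [set F : set (set cantor_space) |
    F `<=` @meager cantor_space /\
    forall A, meager A -> exists2 B, F B & A `<=` B].
  by exists (@meager cantor_space); split=> // A mA; exists A.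
exists _, K, _, D; split=> //.
apply: card_le_trans (infinite_card_square (non_I_square_infinite nD)).
pose psi (p : Xsq * Xsq) := blockwise_differ (cohen_real p.1) (blocks p.2).
apply: card_le_trans (card_image_le psi _); apply: Kmin.2; split.
  by move=> _ [p _ <-]; exact: meager_blocks.
have pick C : I_square C -> exists2 x, D x & ~ C x.
  move=> IC; apply: contrapT => no; apply: nD.
  have [_ Isub _] := I_square_sigma; apply: Isub IC => x Dx.
  by apply: contrapT => nC; apply: no; exists x.
move=> A /square_captures_meager[C /pick[x Dx nx] /(_ x nx)[C' /pick[x' Dx' nx'] AP]].
by exists (psi (x, x')); [exists (x, x')|exact: AP].
Qed.

Lemma non_I_square_le_continuum : non_ideal I_square <=c continuum.
Proof.
have [D nD Dmin] := least_size_exists non_family.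
exists _, D, _, [set: nat -> bool]; split=> //; first exact: card_eqxx.
apply: card_le_trans (card_leT _) _; apply: card_le_trans (card_fun_nat nat).
apply: (@card_le_inj _ _ _ _ (fun (x : Xsq) n => pickle (x n))) => // x y _ _ e.
apply: funext => n; have /= := congr1 (fun f => f n) e.
by move=> /(pcan_inj pickleK).
Qed.

(** * Density, pi-weight and the dominating number *)

Lemma open_body T : P_square T -> open (body T).
Proof.
move=> PT; exists [set T]; first by move=> _ ->.
by rewrite bigcup_set1.
Qed.

Lemma open_cyl s f : open (cyl s f).
Proof. by rewrite -body_bound_tree; apply: open_body; exact: bound_treeP. Qed.

Lemma open_body_sub (O : set Xsq) x : open O -> O x ->
  exists2 T, P_square T & body T `<=` O.
Proof.
move=> [D' D'P <-] [T D'T xT]; exists T; first exact: D'P.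
by move=> y yT; exists T.
Qed.

Lemma least_sizeI T U (F : set (set T)) (K : set U) :
  (exists2 A, F A & A #<= K) -> (forall A, F A -> K #<= A) -> least_size F K.
Proof.
by move=> [A FA AK] KF; split=> //; exists A => //; rewrite card_eq_le AK KF.
Qed.

Lemma dominating_infinite D : dominating D -> infinite_set D.
Proof.
move=> domD /finite_set_countable Dc.
have [|u uD uP] := card_le_surj_fun Dc; first by have [g] := domD (fun=> 0); exists g.
have [_ /uP[m _ <-] [N NP]] := domD (fun n => (\max_(i < n.+1) u i n).+1).
have := NP (maxn N m) (leq_maxl _ _); rewrite ltnNge => /negP; apply.
have mM : m < (maxn N m).+1 by rewrite ltnS leq_maxr.
exact: (@leq_bigmax _ (fun i : 'I_(maxn N m).+1 => u i (maxn N m)) (Ordinal mM)).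
Qed.

Definition pi_base (B : set (set Xsq)) :=
  (forall U, B U -> open U /\ U !=set0) /\
  (forall O : set Xsq, open O -> O !=set0 -> exists2 U, B U & U `<=` O).

Definition dense_trees (F : set (set node)) :=
  F `<=` P_square /\ forall T, P_square T -> exists2 S, F S & S `<=` T.

Lemma dominating_dense_trees D : dominating D ->
  exists2 F, dense_trees F & F #<= D.
Proof.
move=> domD.
pose h (p : (nat -> nat) * nat) : set node :=
  if unpickle p.2 is Some (s, k) then bound_tree s (fun t => p.1 (pickle t) + k)
  else setT.
exists (h @` (D `*` setT)); last first.
  apply: card_le_trans (card_image_le _ _) _.
  exact: infinite_card_setX_nat (dominating_infinite domD).
split=> [_ [[g n] _ <-]|T /bound_tree_sub[s [f sfT]]].
  rewrite /h /=; case: unpickle => [[s k]|]; last exact: P_square_setT.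
  exact: bound_treeP.
pose f' n := if unpickle n is Some t then f t else 0.
have [g Dg [N NP]] := domD f'.
(* Adding [k] repairs the finitely many values below [N], turning eventual into everywhere
   domination. *)
pose k := \max_(n < N) f' n.
exists (h (g, pickle (s, k))); first by exists (g, pickle (s, k)).
rewrite /h /= pickleK => t tT; apply: sfT.
case: tT => [ts|st]; [by left|right; apply: admissible_mono st => u _].
have -> : f u = f' (pickle u) by rewrite /f' pickleK.
have [Nu|uN] := leqP N (pickle u); first by rewrite (leq_trans (NP _ Nu)) ?leq_addr.
apply: leq_trans (leq_addl _ _).
exact: (@leq_bigmax _ (fun n : 'I_N => f' n) (Ordinal uN)).
Qed.

Lemma dense_trees_pi_base F : dense_trees F -> pi_base (body @` F).
Proof.
move=> [FP Fd]; split=> [_ [T /FP PT <-]|O Oo [x Ox]].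
  split; first exact: open_body.
  have [s [f sfT]] := bound_tree_sub PT; have [x] := cyl_nonempty s f.
  by rewrite -body_bound_tree => xT; exists x => n; exact: sfT.
have [T /Fd[S FS ST] TO] := open_body_sub Oo Ox.
exists (body S); first by exists S.
by move=> y yS; apply: TO => n; apply: ST.
Qed.

Lemma pi_base_dense B : pi_base B -> exists2 E : set Xsq, dense E & E #<= B.
Proof.
move=> [BO BB].
have /choice[c cP] (U : set Xsq) : exists x, B U -> U x.
  by have [/BO[_ [x Ux]]|] := pselect (B U); [exists x|exists (fun=> (0, 0))].
exists (c @` B); last exact: card_image_le.
move=> O O0 Oo; have [U BU UO] := BB O Oo O0.
exists (c U); split; first by apply: UO; exact: cP.
by exists U.
Qed.

(** The cylinder with bound [f (size t)] at [t] is open, and the first coordinates of its points lie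
    above [f] everywhere. *)
Lemma dense_dominating E : dense E -> dominating ((fun (x : Xsq) n => (x n).1) @` E).
Proof.
move=> dE f.
have [x [xf Ex]] := dE _ (cyl_nonempty [::] (fun t => f (size t))) (open_cyl _ _).
exists (fun n => (x n).1); first by exists x.
by exists 0 => n _; have [] := xf.2 n isT; rewrite size_mkseq.
Qed.

(** Dominating families give dense families of trees, these give pi-bases, then dense sets, then
    dominating families again, never growing in size, so all four least sizes agree. *)
Lemma square_densities : exists K : set (nat -> nat),
  [/\ dominating_number K, dens Xsq K, piweight Xsq K &
      poset_dens P_square subset K].
Proof.
have [|K domK Kmin] := @least_size_exists _ dominating.
  by exists setT => f; exists f => //; exists 0.
have [F FP FK] := dominating_dense_trees domK.
have BP := dense_trees_pi_base FP; have BK := card_le_trans (card_image_le body F) FK.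
have [E Ed EB] := pi_base_dense BP; have EK := card_le_trans EB BK.
have lowE (E' : set Xsq) : dense E' -> K #<= E'.
  move=> dE'; have h := Kmin.2 _ (dense_dominating dE').
  exact: card_le_trans h (card_image_le _ _).
have lowB B : pi_base B -> K #<= B.
  by move=> /pi_base_dense[E' /lowE h E'B]; exact: card_le_trans h E'B.
have lowF G : dense_trees G -> K #<= G.
  by move=> /dense_trees_pi_base/lowB h; apply: card_le_trans h (card_image_le _ _).
exists K; split=> //; apply: least_sizeI => //.
- by exists E.
- by exists (body @` F).
- by exists F.
Qed.

(** * The pseudointersection number *)

Lemma finite_bound T (G : set T) (h : T -> nat) :
  finite_set G -> exists M, forall i, G i -> h i <= M.
Proof.
move=> /(finite_image h)/finite_seqP[s hs].
exists (\max_(n <- s) n) => i Gi.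
have his : h i \in s by have : (h @` G) (h i); [exists i|rewrite hs].
by apply: (@leq_bigmax_seq _ s xpredT id).
Qed.

Lemma unbounded_infinite T (G : set T) (h : T -> nat) :
  (forall M, exists2 x, G x & M < h x) -> infinite_set G.
Proof.
move=> unb /(finite_bound h)[M hM]; have [x Gx] := unb M.
by rewrite ltnNge hM.
Qed.

Lemma infinite_setI_almost T (A B : set T) :
  infinite_set A -> finite_set (A `\` B) -> infinite_set (A `&` B).
Proof.
move=> Ainf fD fI; apply: Ainf.
by rewrite -(setUIDK A B) finite_setU.
Qed.

Lemma infinite_setX_nat T (A : set T) : infinite_set A -> infinite_set (A `*` [set: nat]).
Proof.
move=> Ainf fin; apply: Ainf; apply: card_le_finite fin.
by apply: (@card_le_inj _ _ _ _ (fun x => (x, 0))) => [x Ax|x y _ _ []].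
Qed.

(** This expresses through indexed families that [L] is smaller than the pseudointersection number;
    as no cardinal is named, the property passes to smaller index sets directly. *)
Definition pseudo_intersectable T (L : set T) := forall A : T -> set nat,
  (forall G, finite_set G -> G `<=` L -> infinite_set (\bigcap_(i in G) A i)) ->
  exists2 B, infinite_set B & forall i, L i -> almost_subset B (A i).

Lemma pseudo_intersectable_le T U (L : set T) (M : set U) :
  M #<= L -> pseudo_intersectable L -> pseudo_intersectable M.
Proof.
move=> ML smallL A centred.
have [M0|/set0P M0] := eqVneq M set0.
  by exists setT; [exact: infinite_nat|rewrite M0].
have [u uM uP] := card_le_surj_fun ML M0.
have [|B Binf BP] := smallL (A \o u).
  move=> G Gfin _; apply: sub_infinite_set (centred (u @` G) (finite_image u Gfin) _).
    by move=> n nG i Gi; apply: nG; exists i.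
  by move=> _ [x _ <-].
by exists B => // i /uP[x Lx <-]; exact: BP.
Qed.

Lemma pseudo_intersection (S : countType) T (L : set T) (A : T -> set S) :
  pseudo_intersectable L -> L !=set0 ->
  (forall G, finite_set G -> G `<=` L -> infinite_set (\bigcap_(i in G) A i)) ->
  exists2 B, infinite_set B & forall i, L i -> finite_set (B `\` A i).
Proof.
move=> smallL [i0 Li0] centred.
have inj_pickle : injective (@pickle S) := pcan_inj (@pickleK S).
have [|B Binf BP] := smallL (fun i => pickle @` A i).
  move=> G Gfin GL; apply: sub_infinite_set (_ : infinite_set (pickle @` \bigcap_(i in G) A i)).
    by move=> _ [x xG <-] i Gi; exists x => //; exact: xG.
  move=> fin; apply: (centred G Gfin GL); apply: card_le_finite fin.
  apply: (@card_le_inj _ _ _ _ pickle) => [x Gx|x y _ _ /inj_pickle //].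
  by exists x.
(* Almost all of [B] lies in the image of [A i0], so infinitely many members of [B] are codes. *)
exists (pickle @^-1` B) => [fin|i Li].
  apply: (infinite_setI_almost Binf (BP i0 Li0)).
  apply: sub_finite_set (finite_image pickle fin) => n [Bn [x _ xn]].
  by exists x => //=; rewrite xn.
apply: card_le_finite (BP i Li).
apply: (@card_le_inj _ _ _ _ pickle) => [x [Bx nAx]|x y _ _ /inj_pickle //].
by split=> // -[y Ay /inj_pickle yx]; apply: nAx; rewrite -yx.
Qed.

(** This is the inequality between the pseudointersection and bounding numbers: a pseudointersection
    of the regions above the graphs is thinned to a single function. *)
Lemma dominate_nat T (L : set T) (H : T -> nat -> nat) :
  pseudo_intersectable (L `*` [set: nat]) -> L !=set0 ->
  exists d : nat -> nat, forall i, L i -> exists N, forall n, N <= n -> H i n <= d n.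
Proof.
move=> smallL [i0 Li0].
(* The pseudointersection may skip column [n]; with a monotone majorant, a point in a later column
   still bounds the value at [n]. *)
pose h i n := \max_(k < n.+1) H i k.
have Hh i n k : k <= n -> H i k <= h i n.
  rewrite -ltnS => kn.
  exact: (@leq_bigmax _ (fun k : 'I_n.+1 => H i k) (Ordinal kn)).
pose A (p : T * nat) : set (nat * nat) := [set q | p.2 <= q.1 /\ h p.1 q.1 <= q.2].
have [|G Gfin _|B Binf BP] := pseudo_intersection (A := A) smallL.
- by exists (i0, 0).
- have [N NP] := finite_bound snd Gfin.
  apply: (unbounded_infinite (h := fst)) => M.
  pose n := (maxn N M).+1.
  have [m mP] := finite_bound (fun p : T * nat => h p.1 n) Gfin.
  exists (n, m); last by rewrite /= ltnS leq_maxr.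
  move=> p Gp; split=> /=; last exact: mP.
  by apply: leq_trans (NP p Gp) _; rewrite leqW // leq_maxl.
have /choice[c cP] n : exists q, B q /\ n <= q.1.
  have := infinite_setI_almost Binf (BP (i0, n) (conj Li0 I)).
  by move=> /infinite_setN0[q [Bq [nq _]]]; exists q.
exists (fun n => (c n).2) => i Li.
have [N NP] := finite_bound fst (BP (i, 0) (conj Li I)).
exists N.+1 => n Nn; have [Bc nc] := cP n.
apply: leq_trans (Hh i _ _ nc) _; rewrite leqNgt; apply/negP => lt.
have : (c n).1 <= N by apply: NP; split=> // -[_] /=; rewrite leqNgt lt.
by rewrite leqNgt (leq_trans Nn nc).
Qed.

Lemma dominate (S : countType) T (L : set T) (H : T -> S -> nat) :
  pseudo_intersectable (L `*` [set: nat]) -> L !=set0 ->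
  exists d : S -> nat, forall i, L i -> exists N, forall s, N <= pickle s -> H i s <= d s.
Proof.
move=> smallL L0.
have [d dP] := dominate_nat
  (fun i n => if unpickle n is Some s then H i s else 0) smallL L0.
exists (fun s => d (pickle s)) => i /dP[N NP]; exists N => s /NP /=.
by rewrite pickleK.
Qed.

(** Only finitely many [s] have a code below [N], and [h] is bounded on them. *)
Lemma pickle_cofinal (S : countType) (h : S -> nat) N :
  exists M, forall s, M <= h s -> N <= pickle s.
Proof.
pose h' n := if unpickle n is Some s then h s else 0.
exists (\max_(n < N) h' n).+1 => s Ms; rewrite leqNgt; apply/negP => sN.
move: Ms; rewrite ltnNge => /negP; apply.
have -> : h s = h' (pickle s) by rewrite /h' pickleK.
exact: (@leq_bigmax _ (fun n : 'I_N => h' n) (Ordinal sN)).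
Qed.

(* A dominating function [f] turns the problem into one about the countable
   tree of [f]-admissible nodes, where pseudointersections of the sets of good
   successors and a second dominating function yield a generic branch. *)
Lemma square_generic T (L : set T) (C : T -> set Xsq) :
  infinite_set L -> pseudo_intersectable L -> (forall i, L i -> N_square (C i)) ->
  exists x, forall i, L i -> ~ C i x.
Proof.
move=> Linf smallL NC.
have Lnat := infinite_card_setX_nat Linf; have L0 := infinite_setN0 Linf.
have smallLn := pseudo_intersectable_le Lnat smallL.
(* Indexing the bounds by [i] and the code of an escaping node keeps the number of functions to
   dominate at the size of [L]. *)
have /choice[F FP] (p : T * nat) : exists g : node -> nat, forall s : node,
    pickle s = p.2 -> escape (C p.1) s -> cyl s g `&` C p.1 = set0.
  have [[s [ps [g gC]]]|no] :=
      pselect (exists s : node, pickle s = p.2 /\ escape (C p.1) s).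
    by exists g => s'; rewrite -ps => /(pcan_inj pickleK) ->.
  by exists (fun=> 0) => s ps Es; case: no; exists s.
have [||f fP] := dominate (L := L `*` [set: nat]) F.
- apply: (pseudo_intersectable_le _ smallL); apply: card_le_trans Lnat.
  exact: infinite_card_setX_nat (infinite_setX_nat Linf).
- by have [i Li] := L0; exists (i, 0).
pose g i (s : node) := F (i, pickle s).
have gP i s : escape (C i) s -> cyl s (g i s) `&` C i = set0 by exact: (FP (i, pickle s)).
(* From a good node on, [f] stays above the bound of an escaping cylinder, so [cyl t f] misses
   [C i]. *)
pose good i := [set t | exists s, [/\ escape (C i) s, admissible (g i s) s t &
  forall u, prefix t u -> g i s u <= f u]].
have good_cyl i t : good i t -> cyl t f `&` C i = set0.
  move=> [s [Es st gf]]; rewrite -subset0 -(gP i s Es); apply: setSI.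
  exact: cyl_sub st gf.
have good_up i t t' : good i t -> admissible f t t' -> good i t'.
  move=> [s [Es st gf]] tt'; exists s; split=> //; last first.
    by move=> u t'u; apply: gf; apply: prefix_trans t'u; case: tt'.
  by apply: admissible_trans st _; apply: admissible_mono tt' => u; exact: gf.
have good_ext i t : L i -> exists2 t', admissible f t t' & good i t'.
  move=> Li; have [s [h [ts sC]]] := (N_squareP _).1 (NC i Li) t f.
  have Es : escape (C i) s by exists h.
  (* Long nodes have large codes, hence lie where [f] dominates [g i s]. *)
  have [N NP] := fP (i, pickle s) (conj Li I); have [M MP] := pickle_cofinal (size : node -> nat) N.
  have [t' st' Mt'] := admissible_extend (fun u => maxn (f u) (g i s u)) s M.
  exists t'.
    by apply: admissible_trans ts _; apply: admissible_mono st' => u _; exact: leq_maxl.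
  exists s; split=> //.
    by apply: admissible_mono st' => u _; exact: leq_maxr.
  move=> u t'u; apply: NP; apply: MP; apply: leq_trans Mt' _.
  exact: size_prefix.
have good_ext_fin G t n : finite_set G -> G `<=` L ->
    exists2 t', admissible f t t' & n < size t' /\ forall i, G i -> good i t'.
  move=> [m Gm] GL; have [t0 tt0 nt0] := admissible_extend f t n.+1.
  suff [t' tt' t'G] : exists2 t', admissible f t0 t' & forall i, G i -> good i t'.
    exists t'; first exact: admissible_trans tt'.
    by split=> //; apply: leq_trans nt0 _; case: tt' => /size_prefix.
  have [->|/set0P G0] := eqVneq G set0; first by exists t0 => //; exact: admissible_refl.
  have [|u uG uP] := card_le_surj_fun (_ : G #<= `I_m) G0.
    by move: Gm; rewrite card_eq_le => /andP[].
  suff [t' tt' t'P] : exists2 t', admissible f t0 t' & forall k, k < m -> good (u k) t'.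
    by exists t' => // i /uP[k km <-]; exact: t'P.
  elim: m {Gm uP} => [|m [t1 t01 t1P]]; first by exists t0 => //; exact: admissible_refl.
  have [t2 t12 t2P] := good_ext (u m) t1 (GL _ (uG m)).
  exists t2 => [|k]; first exact: admissible_trans t12.
  rewrite ltnS leq_eqVlt => /orP[/eqP -> //|/t1P].
  by move=> /good_up; apply.
pose succ t i : set node := [set t' | [/\ admissible f t t', size t < size t' & good i t']].
have /choice[B BP] t : exists B : set node, infinite_set B /\
    forall i, L i -> finite_set (B `\` succ t i).
  have [G Gfin GL|B Binf BP] := pseudo_intersection (A := succ t) smallL L0.
    apply: (unbounded_infinite (h := size)) => M.
    have [t' tt' [st' t'G]] := good_ext_fin G t (maxn M (size t)) Gfin GL.
    exists t'; last by apply: leq_ltn_trans st'; exact: leq_maxl.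
    move=> i Gi; split=> //; last exact: t'G.
    by apply: leq_ltn_trans st'; exact: leq_maxr.
  by exists B.
have /choice[h hP] (i : T) : exists h : node -> nat, forall t, L i ->
    forall t', B t t' -> h t <= pickle t' -> good i t'.
  have /choice[h hP] t : exists n, L i -> forall t', B t t' -> n <= pickle t' -> good i t'.
    have [Li|] := pselect (L i); last by exists 0.
    have [N NP] := finite_bound pickle ((BP t).2 i Li).
    exists N.+1 => _ t' Bt' Nt'; apply: contrapT => ng.
    have : pickle t' <= N by apply: NP; split=> // -[].
    by rewrite leqNgt Nt'.
  by exists h.
(* [h i t] marks where the members of [B t] become good for [i]; a member coded beyond [d t] is then
   good for each [i] at all but finitely many [t]. *)
have [d dP] := dominate h smallLn L0.
have /choice[next nextP] t : exists t', [/\ B t t', admissible f t t',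
    size t < size t' & d t <= pickle t'].
  (* Almost containment in a single [succ t i] already makes infinitely many members of [B t]
     admissible and longer than [t]. *)
  have [i Li] := L0; have [Binf /(_ i Li) Bi] := BP t.
  have inf := infinite_setI_almost Binf Bi.
  have : exists2 t', (B t `&` succ t i) t' & d t <= pickle t'.
    apply: contrapT => no; apply: inf.
    have fin : finite_set (@pickle node @` (B t `&` succ t i)).
      apply: sub_finite_set (finite_II (d t)) => _ [t' Bt' <-] /=.
      by rewrite ltnNge; apply/negP => h1; apply: no; exists t'.
    apply: card_le_finite fin; apply: (@card_le_inj _ _ _ _ pickle).
      by move=> t' Bt'; exists t'.
    by move=> t1 t2 _ _ /(pcan_inj pickleK).
  by move=> [t' [Bt' [tt' st' _]] dt']; exists t'.
pose t k := iter k next [::].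
have kt k : k <= size (t k).
  by elim: k => // k IH; apply: leq_ltn_trans IH _; case: (nextP (t k)).
have [k|x xt] := @branch t _ kt; first by case: (nextP (t k)) => _ [].
have tcyl k : cyl (t k) f x.
  apply: (@branch_cyl _ _ (fun j => t (k + j))) => j.
  - by apply: leq_trans (kt _); exact: leq_addl.
  - exact: xt.
  - elim: j => [|j IH]; first by rewrite addn0; exact: admissible_refl.
    by rewrite addnS; apply: admissible_trans IH _; case: (nextP (t (k + j))).
exists x => i Li; have [N NP] := dP i Li; have [M MP] := pickle_cofinal (size : node -> nat) N.
have [Bn _ _ dn] := nextP (t M).
have gn : good i (t M.+1).
  by apply: (hP i (t M)) => //; apply: leq_trans dn; apply/NP/MP/kt.
exact: (disjointP (good_cyl _ _ gn) (tcyl M.+1)).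
Qed.

(** Replacing each member of the cover by countably many nowhere dense sets keeps the index set
    small, and a generic point would then lie in no member. *)
Lemma not_pseudo_intersectable_cover L : L `<=` I_square ->
  \bigcup_(A in L) A = setT -> ~ pseudo_intersectable L.
Proof.
move=> LI Lcov smallL.
have Linf : infinite_set L.
  move=> /finite_set_countable Lc; apply: I_square_proper; rewrite -Lcov.
  exact: I_square_countable_bigcup.
have /choice[C CP] A : exists C, L A -> null_cover A C.
  by have [/LI/I_squareP[C]|] := pselect (L A); [exists C|exists (fun=> set0)].
have [|||x xP] := @square_generic _ (L `*` [set: nat]) (fun p => C p.1 p.2).
- exact: infinite_setX_nat.
- exact: pseudo_intersectable_le (infinite_card_setX_nat Linf) smallL.
- by move=> [A n] [/CP[NC _] _]; exact: NC.
have [A LA Ax] : (\bigcup_(A in L) A) x by rewrite Lcov.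
have [_ /(_ x Ax)[n _]] := CP A LA.
exact: (xP (A, n) (conj LA I)).
Qed.

(** The members of a least cover index a centred family without pseudointersection, and its range is
    no larger than the cover. *)
Lemma p_le_cov_I_square : pseudointersection_number <=c cov_ideal I_square.
Proof.
have [L LF Lmin] := least_size_exists cov_family.
have [LI Lcov] := LF.
have := not_pseudo_intersectable_cover LI Lcov.
move=> /existsNP[A /not_implyP[centred noB]].
set PF := [set F : set (set nat) | [/\ (forall A, F A -> infinite_set A),
        (forall G : set (set nat), finite_set G -> G `<=` F ->
           infinite_set (\bigcap_(A in G) A)) &
        ~ exists2 B : set nat, infinite_set B & forall A, F A -> almost_subset B A]].
have PA : PF (A @` L).
  split=> [_ [i Li <-]|G Gfin GA|[B Binf BP]].
  - have := centred [set i] (finite_set1 i); rewrite bigcap_set1; apply.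
    by move=> _ ->.
  - have /choice[c cP] a : exists i, G a -> L i /\ A i = a.
      by have [/GA[i Li <-]|] := pselect (G a); [exists i|exists set0].
    apply: sub_infinite_set (centred (c @` G) (finite_image c Gfin) _).
      by move=> n nG a Ga; have [_ <-] := cP a Ga; apply: nG; exists a.
    by move=> _ [a /cP[La _] <-].
  - by apply: noB; exists B => // i Li; apply: BP; exists i.
have [K KF Kmin] := least_size_exists (ex_intro _ _ PA : PF !=set0).
exists _, K, _, L; split=> //.
exact: card_le_trans (Kmin.2 _ PA) (card_image_le _ _).
Qed.

Theorem theorem5p2 :
  (add_ideal I_square =c omega1 /\
   cof_ideal I_square =c continuum) /\
  (pseudointersection_number <=c cov_ideal I_square /\
   cov_ideal I_square <=c add_ideal (@meager cantor_space)) /\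
  (cof_ideal (@meager cantor_space) <=c non_ideal I_square /\
   non_ideal I_square <=c continuum) /\
  (dens Xsq =c piweight Xsq /\
   piweight Xsq =c poset_dens P_square subset /\
   poset_dens P_square subset =c dominating_number).
Proof.
have [K [domK densK piK posetK]] := square_densities.
split; first by split; [exact: add_I_square|exact: cof_I_square].
split.
  by split; [exact: p_le_cov_I_square|exact: cov_I_square_le_add_meager].
split.
  by split; [exact: cof_meager_le_non_I_square|exact: non_I_square_le_continuum].
by split; [|split]; exists _, K.
Qed.
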